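(* Let $S$ be a commutative Noetherian ring and let $K$, $L$, $M$ be finitely generated $S$-modules. Let $X := j\text{-}\mathrm{Spec}(S)\cap \mathrm{Supp}_S(K)$, and suppose that for every prime ideal $\mathfrak{p}\in X$ the $S_{\mathfrak p}$-module $K_{\mathfrak p}^{\oplus(1+\dim_X(\mathfrak p))}$ is (isomorphic to) a direct summand of $M_{\mathfrak p}$ over $S_{\mathfrak p}$. Then $K\oplus L\cong K\oplus M$ implies $L\cong M$.
   Context: For a commutative ring $S$, $j\text{-}\mathrm{Spec}(S)$ is the set of prime ideals of $S$ that are intersections of maximal ideals of $S$, with the subspace topology from the Zariski topology on $\mathrm{Spec}(S)$. $\mathrm{Supp}_S(K)=\{\mathfrak p\in \mathrm{Spec}(S): K_{\mathfrak p}\neq 0\}$. The set $X$ has the subspace topology. The Krull dimension of a topological space is the supremum of the lengths of chains of distinct closed irreducible subsets; for $\mathfrak p\in X$, $\dim_X(\mathfrak p)$ is the Krull dimension of the closure of $\{\mathfrak p\}$ in $X$. If $\dim_X(\mathfrak p)=\infty$, the hypothesis at $\mathfrak p$ is read as: $K_{\mathfrak p}^{\oplus n}$ is a direct summand of $M_{\mathfrak p}$ for every nonnegative integer $n$. *)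

(* Defs.v *)
From HB Require Import structures.
From mathcomp Require Import all_boot all_order all_algebra.
From mathcomp Require Import generic_quotient.
From mathcomp Require Import boolp classical_sets topology ring.

Set Implicit Arguments.
Unset Strict Implicit.
Unset Printing Implicit Defensive.

Import GRing.Theory.
Local Open Scope quotient_scope.
Local Open Scope classical_set_scope.
Local Open Scope ring_scope.

(* [comPzRingType] rather than [comNzRingType], so that the zero ring is not
   excluded; ideals are Prop-valued, so they need not be decidable. *)
Section Ideals.
Variable S : comPzRingType.
Implicit Types I J : set S.

Definition ideal I : Prop :=
  [/\ I 0, (forall x y, I x -> I y -> I (x + y))
     & (forall a x, I x -> I (a * x))].

Definition prime_ideal I : Prop :=
  [/\ ideal I, ~ I 1 & forall x y, I (x * y) -> I x \/ I y].

Definition maximal_ideal I : Prop :=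
  [/\ ideal I, ~ I 1 & forall J, ideal J -> ~ J 1 -> I `<=` J -> J = I].

Definition noetherian : Prop :=
  forall I, ideal I -> exists n (g : 'I_n -> S),
    I = [set x | exists c : 'I_n -> S, x = \sum_(i < n) c i * g i].

End Ideals.

Arguments noetherian S : clear implicits.

Section Modules.
Variable R : comPzRingType.

Definition finitely_generated (M : lmodType R) : Prop :=
  exists n (g : 'I_n -> M), forall x, exists c : 'I_n -> R,
    x = \sum_(i < n) c i *: g i.

Definition isomorphic (M N : lmodType R) : Prop :=
  exists f : {linear M -> N}, bijective f.

Definition direct_summand (A M : lmodType R) : Prop :=
  exists B : lmodType R, isomorphic M (A * B)%type.

End Modules.

Record spec (S : comPzRingType) : Type := Spec {
  spec_set :> set S;
  spec_prime : prime_ideal spec_set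
}.

HB.instance Definition _ (S : comPzRingType) := gen_eqMixin (spec S).
HB.instance Definition _ (S : comPzRingType) := gen_choiceMixin (spec S).

Section Zariski.
Variable S : comPzRingType.

Definition zariski_closed (E : set S) : set (spec S) := [set q | E `<=` q].

Definition zariski_open (U : set (spec S)) : Prop :=
  exists E, U = ~` zariski_closed E.

Lemma zariski_openT : zariski_open setT.
Proof.
exists [set 1]; apply/seteqP; split => // q _ /= q1.
by case: (spec_prime q) => _ + _; apply; exact: q1.
Qed.

Lemma zariski_openI : setI_closed zariski_open.
Proof.
move=> _ _ [E ->] [F ->].
exists [set z | exists x y, [/\ E x, F y & z = x * y]].
rewrite -setCU; congr (~` _); apply/seteqP; split => q /=.
- case: (spec_prime q) => -[_ _ qM] _ _.
  case=> sub _ [x [y [Ex Fy ->]]]; last exact: qM (sub _ Fy).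
  by rewrite mulrC; apply: qM (sub _ Ex).
- move=> sub; apply: contrapT => /not_orP[/existsNP[x /not_implyP[Ex qx]]].
  move=> /existsNP[y /not_implyP[Fy qy]].
  case: (spec_prime q) => _ _ qP.
  by have /qP[] : (q : set S) (x * y) by apply: sub; exists x, y.
Qed.

Lemma zariski_open_bigU (I : Type) (f : I -> set (spec S)) :
  (forall i, zariski_open (f i)) -> zariski_open (\bigcup_i f i).
Proof.
move=> fo; have [E fE] := choice fo.
exists (\bigcup_i E i); rewrite (eq_bigcupr (fun i _ => fE i)) -setC_bigcap.
congr (~` _); apply/seteqP; split => q /=.
- by move=> sub x [i _ Eix]; apply: (sub i).
- by move=> sub i _ x Eix; apply: sub; exists i.
Qed.

HB.instance Definition _ := isOpenTopological.Build (spec S)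
  zariski_openT zariski_openI zariski_open_bigU.

Definition jspec : set (spec S) :=
  [set q | exists F : set (set S), (forall m, F m -> maximal_ideal m) /\
    (q : set S) = \bigcap_(m in F) m].

End Zariski.

Arguments jspec S : clear implicits.

(* The dimension of a subset [A] of [T] is obtained by taking [T] to be the
   type [A : Type], which carries the subspace topology
   (subtype_topology.v). *)
Section Dimension.
Variable T : topologicalType.

Definition irreducible (A : set T) : Prop :=
  A !=set0 /\ forall B C, closed B -> closed C -> A `<=` B `|` C ->
    A `<=` B \/ A `<=` C.

(* A chain of length [n] has [n.+1] members. *)
Definition irreducible_chain (n : nat) : Prop :=
  exists F : 'I_n.+1 -> set T, (forall i, closed (F i) /\ irreducible (F i)) /\
    (forall i j : 'I_n.+1, (i < j)%N -> F i `<` F j).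

Definition has_krull_dim (n : nat) : Prop :=
  irreducible_chain n /\ forall m, irreducible_chain m -> (m <= n)%N.

Definition infinite_krull_dim : Prop :=
  forall n, exists2 m, (n <= m)%N & irreducible_chain m.

(* The two predicates are exhaustive as soon as the space is nonempty, so a
   hypothesis quantified over them is never vacuous at a point closure. *)
Lemma krull_dim_exists : T -> (exists n, has_krull_dim n) \/ infinite_krull_dim.
Proof.
move=> x; have chain0 : irreducible_chain 0.
  exists (fun=> closure [set x]); split; last by move=> i j; rewrite !ord1.
  move=> _; split; first exact: closed_closure.
  split; first by exists x; exact: subset_closure.
  have cx (B : set T) : closed B -> B x -> closure [set x] `<=` B.
    by move=> /closure_id cB Bx; rewrite cB; apply: closureS => _ ->.
  move=> B C cB cC /(_ x (subset_closure erefl))[Bx|Cx]; [left|right]; exact: cx.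
have [|/existsNP[b hb]] := pselect infinite_krull_dim; [by right|left].
have bound m : `[< irreducible_chain m >] -> (m <= b)%N.
  move=> /asboolP hm; rewrite leqNgt; apply/negP => /ltnW bm.
  by apply: hb; exists m.
have ex : exists m, `[< irreducible_chain m >] by exists 0%N; exact/asboolP.
case: (ex_maxnP ex bound) => n /asboolP hn nmax.
by exists n; split => // m hm; apply: nmax; exact/asboolP.
Qed.

End Dimension.

Section Localization.
Variables (S : comPzRingType) (p : spec S).

Definition denom : Type := set_type (~` (p : set S)).
HB.instance Definition _ := Choice.on denom.

Local Notation den := (@sval S (fun s => s \in ~` (p : set S))).

Lemma denom1_subproof : (1 : S) \in ~` (p : set S).
Proof. by rewrite inE; case: (spec_prime p). Qed.
Definition denom1 : denom := Sub (1 : S) denom1_subproof.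

Lemma denomM_subproof (s t : denom) : den s * den t \in ~` (p : set S).
Proof.
rewrite inE => pst; case: (spec_prime p) => _ _ /(_ _ _ pst).
by case: s t {pst} => [s s_p] [t t_p] /=; move: s_p t_p; rewrite !inE /= => ? ? [].
Qed.
Definition denomM (s t : denom) : denom :=
  Sub (den s * den t) (denomM_subproof s t).

Section LocModule.
Variable M : lmodType S.

Definition loc_rel (x y : M * denom) : bool :=
  `[< exists u : denom,
        den u *: (den y.2 *: x.1) = den u *: (den x.2 *: y.1) >].

Lemma loc_rel_equiv : equiv_class_of loc_rel.
Proof.
split.
- by move=> x; apply/asboolP; exists denom1.
- by move=> x y; apply/asboolP/asboolP => -[u e]; exists u; rewrite e.
- move=> [y t] [x s] [z r] /asboolP[u /= e] /asboolP[v /= f].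
  apply/asboolP; exists (denomM t (denomM u v)) => /=.
  rewrite !scalerA in e f *.
  have -> : den t * (den u * den v) * den r =
            (den v * den r) * (den u * den t) by ring.
  have -> : den t * (den u * den v) * den s =
            (den u * den s) * (den v * den t) by ring.
  by rewrite -scalerA e -[in RHS]scalerA -f !scalerA; congr (_ *: _); ring.
Qed.

Canonical loc_rel_equivRel := EquivRelPack loc_rel_equiv.

Definition loc : Type := {eq_quot loc_rel_equivRel}.
HB.instance Definition _ := Choice.on loc.
HB.instance Definition _ := EqQuotient.on loc.

Definition loc_frac (m : M) (s : denom) : loc := \pi_loc (m, s).

Lemma eq_loc_frac (m n : M) (s t : denom) : loc_frac m s = loc_frac n t <->
  exists u : denom, den u *: (den t *: m) = den u *: (den s *: n).
Proof.
rewrite /loc_frac; split.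
- by move=> /eqmodP /asboolP.
- by move=> h; apply/eqmodP/asboolP.
Qed.

Lemma loc_fracP (x : loc) : exists m s, x = loc_frac m s.
Proof.
by exists (repr x).1, (repr x).2; rewrite /loc_frac -surjective_pairing reprK.
Qed.

Definition loc_zero : loc := loc_frac 0 denom1.

Definition loc_opp (x : loc) : loc := loc_frac (- (repr x).1) (repr x).2.

Definition loc_add (x y : loc) : loc :=
  let: (m, s) := repr x in let: (n, t) := repr y in
  loc_frac (den t *: m + den s *: n) (denomM s t).

Lemma repr_loc_frac (m : M) (s : denom) : exists n t u,
  repr (loc_frac m s) = (n, t) /\
  den u *: (den t *: m) = den u *: (den s *: n) :> M.
Proof.
case E : (repr (loc_frac m s)) => [n t].
have /eq_loc_frac[u e] : loc_frac m s = loc_frac n t by rewrite {2}/loc_frac -E reprK.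
by exists n, t, u.
Qed.

Lemma loc_oppE (m : M) (s : denom) : loc_opp (loc_frac m s) = loc_frac (- m) s.
Proof.
have [n [t [u [E e]]]] := repr_loc_frac m s.
by rewrite /loc_opp E /=; apply/eq_loc_frac; exists u; rewrite !scalerN e.
Qed.

Lemma loc_addE (m n : M) (s t : denom) : loc_add (loc_frac m s) (loc_frac n t) =
  loc_frac (den t *: m + den s *: n) (denomM s t).
Proof.
have [m' [s' [u [E e]]]] := repr_loc_frac m s.
have [n' [t' [v [F f]]]] := repr_loc_frac n t.
rewrite /loc_add E F; apply/eq_loc_frac; exists (denomM u v) => /=.
rewrite !scalerDr !scalerA in e f *; congr (_ + _).
- have -> : den u * den v * (den s * den t) * den t' =
    (den v * den t * den t') * (den u * den s) by ring.
  by rewrite -scalerA -e scalerA; congr (_ *: _); ring.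
- have -> : den u * den v * (den s * den t) * den s' =
    (den u * den s * den s') * (den v * den t) by ring.
  by rewrite -scalerA -f scalerA; congr (_ *: _); ring.
Qed.

Lemma loc_addA : associative loc_add.
Proof.
move=> x y z; have [m [s ->]] := loc_fracP x; have [n [t ->]] := loc_fracP y.
have [k [r ->]] := loc_fracP z; rewrite !loc_addE; apply/eq_loc_frac; exists denom1.
rewrite /= !scalerDr !scalerA -!addrA.
by congr (_ *: _ + (_ *: _ + _ *: _)); ring.
Qed.

Lemma loc_addC : commutative loc_add.
Proof.
move=> x y; have [m [s ->]] := loc_fracP x; have [n [t ->]] := loc_fracP y.
rewrite !loc_addE; apply/eq_loc_frac; exists denom1.
by rewrite /= !scalerDr !scalerA addrC; congr (_ *: _ + _ *: _); ring.
Qed.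

Lemma loc_add0 : left_id loc_zero loc_add.
Proof.
move=> x; have [m [s ->]] := loc_fracP x; rewrite !loc_addE; apply/eq_loc_frac.
by exists denom1; rewrite /= !scaler0 add0r !scalerA; congr (_ *: _); ring.
Qed.

Lemma loc_addN : left_inverse loc_zero loc_opp loc_add.
Proof.
move=> x; have [m [s ->]] := loc_fracP x; rewrite loc_oppE loc_addE.
by apply/eq_loc_frac; exists denom1; rewrite /= scalerN addNr !scaler0.
Qed.

HB.instance Definition _ :=
  GRing.isZmodule.Build loc loc_addA loc_addC loc_add0 loc_addN.

End LocModule.

Section Scale.
Variable M : lmodType S.

Definition loc_scale (a : loc S^o) (x : loc M) : loc M :=
  let: (b, s) := repr a in let: (m, t) := repr x in
  loc_frac ((b : S) *: m) (denomM s t).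

Lemma loc_scaleE (b : S) (m : M) (s t : denom) :
  loc_scale (loc_frac (b : S^o) s) (loc_frac m t) = loc_frac (b *: m) (denomM s t).
Proof.
have [b' [s' [u [E e]]]] := repr_loc_frac (b : S^o) s.
have [m' [t' [v [F f]]]] := repr_loc_frac m t.
rewrite /loc_scale E F; apply/eq_loc_frac; exists (denomM u v) => /=.
rewrite !scalerA in f *; rewrite /GRing.scale /= in e.
have -> : den u * den v * (den s * den t) * b' =
  (den u * (den s * b')) * (den v * den t) by ring.
by rewrite -e -[LHS]scalerA -f scalerA; congr (_ *: _); ring.
Qed.

End Scale.

Lemma loc_scaleA (M : lmodType S) (a b : loc S^o) (x : loc M) :
  loc_scale a (loc_scale b x) = loc_scale (loc_scale a b) x.
Proof.
have [c [s ->]] := loc_fracP a; have [d [t ->]] := loc_fracP b.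
have [m [r ->]] := loc_fracP x.
rewrite !loc_scaleE; apply/eq_loc_frac; exists denom1.
by rewrite /= !scalerA; congr (_ *: _); rewrite /GRing.scale /=; ring.
Qed.

Lemma loc_scale1 (M : lmodType S) (x : loc M) :
  loc_scale (loc_frac (1 : S^o) denom1) x = x.
Proof.
have [m [r ->]] := loc_fracP x; rewrite loc_scaleE; apply/eq_loc_frac; exists denom1.
by rewrite /= !scalerA; congr (_ *: _); ring.
Qed.

Lemma loc_scaleDr (M : lmodType S) (a : loc S^o) :
  {morph loc_scale (M := M) a : x y / x + y}.
Proof.
move=> x y; have [c [s ->]] := loc_fracP a.
have [m [t ->]] := loc_fracP x; have [n [r ->]] := loc_fracP y.
rewrite /GRing.add /= loc_addE !loc_scaleE loc_addE; apply/eq_loc_frac.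
exists denom1; rewrite /= !scalerDr !scalerA.
by congr (_ *: _ + _ *: _); ring.
Qed.

Lemma loc_scaleDl (M : lmodType S) (x : loc M) :
  {morph (fun a : loc S^o => loc_scale a x) : a b / a + b}.
Proof.
move=> a b; have [c [s ->]] := loc_fracP a; have [d [t ->]] := loc_fracP b.
have [m [r ->]] := loc_fracP x.
rewrite /GRing.add /= loc_addE !loc_scaleE loc_addE; apply/eq_loc_frac.
exists denom1; rewrite /= scalerDl !scalerDr !scalerA.
by congr (_ *: _ + _ *: _); rewrite /GRing.scale /=; ring.
Qed.

(* [loc_scale] with [M := S^o] is multiplication of fractions, so [loc S^o] is
   the local ring at [p]; the alias carries its ring structure. *)
Definition loc_ring : Type := loc S^o.
HB.instance Definition _ := GRing.Zmodule.on loc_ring.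

Lemma loc_mulC : commutative (loc_scale (M := S^o)).
Proof.
move=> a b; have [c [s ->]] := loc_fracP a; have [d [t ->]] := loc_fracP b.
rewrite !loc_scaleE; apply/eq_loc_frac; exists denom1.
by rewrite /GRing.scale /=; ring.
Qed.

HB.instance Definition _ := GRing.Zmodule_isComPzRing.Build loc_ring
  (@loc_scaleA S^o) loc_mulC (@loc_scale1 S^o)
  (fun a b x => @loc_scaleDl S^o x a b).

HB.instance Definition _ (M : lmodType S) :=
  GRing.Zmodule_isLmodule.Build loc_ring (loc M)
    (@loc_scaleA M) (@loc_scale1 M) (@loc_scaleDr M) (@loc_scaleDl M).

End Localization.

Definition Supp (S : comPzRingType) (K : lmodType S) : set (spec S) :=
  [set q | exists x : loc q K, x != 0].

(* Main.v *)
Require Import Defs.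
From HB Require Import structures.
From mathcomp Require Import all_boot all_order all_algebra all_field.
From mathcomp Require Import generic_quotient.
From mathcomp Require Import boolp classical_sets topology zify ring.

(* Put [E := End_S(K)], a module-finite [S]-algebra. The given isomorphism restricts to a
   split injection [(a, w) : K -> K * M], and elementary automorphisms of [K * M] reduce the
   theorem to finding [h : K -> M] such that [w + h a] is split. Composing maps [K -> M]
   with generators of [Hom(M, K)], this becomes a stable range problem for a matrix over
   [E] whose columns come from [w] and from generators of [Hom(K, M)].

   As in the method of Eisenbud and Evans, the columns are removed one at a time, keeping
   the following property: at each [p] in [X] with [dim_X(p) >= n], the identity matrix
   of size [min(n + 1, number of columns)] factors through the matrix over [E_p]. Removing
   a column costs at most one unit of such a rank, and by Noetherianity this loss only has
   to be prevented at finitely many primes, treated one after the other. At one prime,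
   [E_p] is replaced by a semisimple finite-dimensional algebra [A] over the residue field
   such that units lift from [A] to [E_p]. Over [A], the ranks are governed by the
   dimensions of the images of powers of two-sided ideals of [A], and column operations
   that minimize the dimension of the kernel do not decrease them. *)

Set Implicit Arguments.
Unset Strict Implicit.
Unset Printing Implicit Defensive.

Import GRing.Theory.
Local Open Scope ring_scope.

(** * Finite-dimensional semiprime algebras *)

(** The obstacle is that [E] is not commutative: [A] may have several simple factors, and a single
    dimension does not decide whether an identity matrix factors. Testing a matrix against every
    two-sided ideal of [A] bounds its rank in all simple factors at once, without decomposing [A]. A
    second constraint is that [w] may be changed only by maps of the form [h a]. Corrections
    therefore pass through the diagonal matrix [D] with entries [a, 1, ..., 1]. The relation
    [b a + g N = 1], read off from the inverse isomorphism, makes up for [a] not being invertible: a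
    kernel vector [v] can still be recovered from [D v]. The bound [n + 1] is dictated by the end of
    the process, where one column is left and rank 1 must remain at every point of [X]. Finally, [X]
    contains all maximal ideals in the support of [K], so it detects global splitting, and it
    contains every prime that is an intersection of its members, which makes the minimal points of a
    locus finite in number. *)

Section Vspace.
Variables (k : fieldType) (vT : vectType k).

(** A subspace of maximal dimension inside [P] is all of [P], since the line of a missed vector
    could be adjoined. Ideals given by propositions can thus be measured by dimension. *)
Lemma vspace_of_pred (P : vT -> Prop) :
  P 0 -> (forall c u v, P u -> P v -> P (c *: u + v)) ->
  exists U : {vspace vT}, forall v, v \in U <-> P v.
Proof.
move=> P0 PL.
pose Q n := `[< exists2 U : {vspace vT}, \dim U = n & forall v, v \in U -> P v >].
have Q0 : exists n, Q n.
  exists 0%N; apply/asboolP; exists 0%VS; first by rewrite dimv0.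
  by move=> v; rewrite memv0 => /eqP ->.
have Qb n : Q n -> (n <= dim vT)%N.
  by move=> /asboolP[U <- _]; rewrite -dimvf dimvS ?subvf.
case: (ex_maxnP Q0 Qb) => n /asboolP[U dU UP] nmax.
exists U => v; split; first exact: UP.
move=> Pv; apply: contrapT => /negP nvU.
suff /nmax : Q n.+1 by rewrite ltnn.
apply/asboolP; exists (U + <[v]>)%VS.
  have v0 : v != 0 by apply: contraNneq nvU => ->; rewrite mem0v.
  rewrite -dU dimv_disjoint_sum ?dim_vline ?v0 ?addn1 //.
  apply/eqP; rewrite -subv0; apply/subvP => x /memv_capP[xU /vlineP[c xE]].
  rewrite memv0; move: xU; rewrite xE.
  have [->|c0] := eqVneq c 0; first by rewrite scale0r.
  by rewrite rpredZeq (negPf c0) (negPf nvU).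
move=> _ /memv_addP[u uU [_ /vlineP[c ->] ->]].
by rewrite addrC; apply: PL => //; exact: UP.
Qed.

Definition power_val t (T : {vspace vT}) (f : {ffun 'I_t -> subvs_of T}) :
  {ffun 'I_t -> vT} := [ffun i => vsval (f i)].

Fact power_val_linear t (T : {vspace vT}) : linear (@power_val t T).
Proof. by move=> c f g; apply/ffunP => i; rewrite !ffunE linearP. Qed.

HB.instance Definition _ t (T : {vspace vT}) := GRing.isLinear.Build _ _ _ _ _
  (@power_val_linear t T).

Definition power_vspace (t : nat) (T : {vspace vT}) : {vspace {ffun 'I_t -> vT}} :=
  limg (linfun (@power_val t T)).

Lemma mem_power_vspace t T (v : {ffun 'I_t -> vT}) :
  v \in power_vspace t T <-> forall i, v i \in T.
Proof.
split=> [/memv_imgP[f _ ->] i|vT'].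
  by rewrite lfunE ffunE subvsP.
apply/memv_imgP; exists [ffun i => vsproj T (v i)]; first exact: memvf.
by rewrite lfunE; apply/ffunP => i; rewrite !ffunE vsprojK.
Qed.

Lemma dim_power_vspace t T : \dim (power_vspace t T) = (t * \dim T)%N.
Proof.
rewrite limg_dim_eq.
  by rewrite dimvf /dim /= card_ord.
apply/eqP; rewrite capfv -subv0; apply/subvP => f; rewrite memv_ker lfunE memv0.
move=> /eqP/ffunP f0; apply/eqP/ffunP => i; apply: val_inj.
by have := f0 i; rewrite !ffunE.
Qed.

End Vspace.

(** For a finite-dimensional algebra this is semisimplicity. Square-zero ideals are what a descent
    on the dimension can remove one by one. *)
Definition semiprime (k : fieldType) (A : falgType k) : Prop :=
  forall J : {vspace A}, (J * fullv <= J)%VS -> (fullv * J <= J)%VS ->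
    (J * J)%VS = 0%VS -> J = 0%VS.

Section SemiprimeAlgebra.
Variables (k : fieldType) (A : falgType k).
Hypothesis Asp : semiprime A.
Implicit Types (Y : {vspace A}).

Definition right_ideal Y : Prop := forall x a, x \in Y -> x * a \in Y.
Definition left_ideal Y : Prop := forall x a, x \in Y -> a * x \in Y.

(** Brauer's argument. If [x * y != 0] with [x], [y] in [Y], either [x Y] is a smaller nonzero right
    ideal, or left multiplication by [x] is bijective on [Y]; then [x = x * e] with [e] in [Y]
    forces [e * e = e]. If [Y] squares to zero, so does the two-sided ideal [A Y], against
    semiprimeness. *)
Lemma right_ideal_idempotent Y : right_ideal Y -> Y != 0%VS ->
  exists e, [/\ e \in Y, e * e = e & e != 0].
Proof.
have [n] := ubnP (\dim Y); elim: n => // n IH in Y * => dY rY Y0.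
have [[x xY [y yY xy0]]|sq0] : (exists2 x, x \in Y & exists2 y, y \in Y & x * y != 0)
    \/ forall x y, x \in Y -> y \in Y -> x * y = 0.
- have [?|N] := pselect (exists2 x, x \in Y & exists2 y, y \in Y & x * y != 0); [by left|right].
  move=> x y xY yY; apply: contrapT => /eqP xy; apply: N.
  by exists x => //; exists y.
- pose f := amull x.
  have fY : (f @: Y <= Y)%VS.
    by apply/subvP => _ /memv_imgP[z zY ->]; rewrite lfunE /=; exact: rY.
  have r_fY : right_ideal (f @: Y).
    move=> _ a /memv_imgP[z zY ->]; apply/memv_imgP; exists (z * a); first exact: rY.
    by rewrite !lfunE /= mulrA.
  have fY0 : (f @: Y)%VS != 0%VS.
    apply/eqP => f0; move: xy0; have : f y \in (f @: Y)%VS by exact: memv_img.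
    by rewrite f0 memv0 lfunE /= => ->.
  have [dfY|dfY] := ltnP (\dim (f @: Y)) (\dim Y).
    have [|e [eY ee e0]] := IH _ _ r_fY fY0; first lia.
    by exists e; split => //; exact: (subvP fY).
  have fYE : (f @: Y)%VS = Y by apply/eqP; rewrite eqEdim fY dfY.
  have /memv_imgP[e eY] : x \in (f @: Y)%VS by rewrite fYE.
  rewrite lfunE /= => xe; exists e; split => //; last first.
    by apply: contraNneq xy0 => e0; rewrite xe e0 mulr0 mul0r.
  have kf : (Y :&: lker f)%VS = 0%VS.
    by apply/eqP; rewrite -dimv_eq0; have := limg_ker_dim f Y; rewrite fYE; lia.
  apply/eqP; rewrite -subr_eq0 -memv0 -kf memv_cap memv_ker lfunE /=.
  by rewrite rpredB //= ?rY // mulrBr mulrA -xe -xe subrr.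
- case/negP: Y0; rewrite -subv0.
  have YY : (Y * Y)%VS = 0%VS.
    apply/eqP; rewrite -subv0; apply/prodvP => u v uY vY.
    by rewrite sq0 // mem0v.
  have YA : (Y * fullv <= Y)%VS by apply/prodvP => u v uY _; exact: rY.
  have J0 : (fullv * Y)%VS = 0%VS.
    apply: Asp.
    - by rewrite -prodvA prodvSr.
    - by rewrite prodvA prodvSl // subvf.
    - apply/eqP; rewrite -subv0 prodvA -[X in (X * _)%VS]prodvA.
      rewrite (subv_trans (prodvSl _ (prodvSr _ YA))) //.
      by rewrite -prodvA YY prodv0.
  apply/subvP => y yY; rewrite -J0 -[y]mul1r; apply: memv_mul => //.
  exact: memvf.
Qed.

(** An idempotent [e] of [Y] can be enlarged as long as [Y] has a nonzero idempotent [f] with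
    [e * f = 0]. At the end [y - e * y], which [e] kills, must vanish. *)
Lemma right_ideal_principal Y : right_ideal Y ->
  exists e, [/\ e \in Y, e * e = e & forall y, y \in Y -> e * y = y].
Proof.
move=> rY; suff H n e : e \in Y -> e * e = e -> (\dim Y - \dim (amull e @: fullv) < n)%N ->
    exists e, [/\ e \in Y, e * e = e & forall y, y \in Y -> e * y = y].
  by apply: (H (\dim Y).+1 0); rewrite ?mem0v ?mulr0 //; lia.
elim: n e => // n IH e eY ee de.
have [/eqP Y1|Y1] := eqVneq (Y :&: lker (amull e))%VS 0%VS.
  exists e; split=> // y yY; apply/esym/eqP; rewrite -subr_eq0 -memv0.
  rewrite -(eqP Y1) memv_cap memv_ker lfunE /= rpredB ?rY //=.
  by rewrite mulrBr mulrA ee subrr.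
have [|f [/memv_capP[fY]]] := right_ideal_idempotent _ Y1.
  move=> x a /memv_capP[xY]; rewrite memv_ker memv_cap memv_ker !lfunE /= => /eqP ex.
  by rewrite rY // mulrA ex mul0r /=.
rewrite memv_ker lfunE /= => /eqP ef ff f0.
(* Only [e * f = 0] is known; subtracting [f * e] yields [e' * e = e] and [e' * f = f], so [e A] is
   strictly contained in [e' A]. *)
pose e' := e + f - f * e.
have e'Y : e' \in Y by rewrite rpredB ?rpredD // rY.
have e'e : e' * e = e by rewrite mulrBl mulrDl ee -mulrA ee addrK.
have e'f : e' * f = f by rewrite mulrBl mulrDl ef ff -mulrA ef mulr0 subr0 add0r.
apply: (IH e') => //; first by rewrite {2}/e' mulrBr mulrDr e'e e'f mulrA e'f.
suff : (\dim (amull e @: fullv) < \dim (amull e' @: fullv) <= \dim Y)%N by lia.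
apply/andP; split; last first.
  by apply: dimvS; apply/subvP => _ /memv_imgP[z _ ->]; rewrite lfunE /= rY.
rewrite ltnNge; apply/negP => d.
have sub : (amull e @: fullv <= amull e' @: fullv)%VS.
  apply/subvP => _ /memv_imgP[z _ ->]; rewrite lfunE /=.
  by apply/memv_imgP; exists (e * z); rewrite ?memvf // lfunE /= mulrA e'e.
have /eqP E : (amull e @: fullv == amull e' @: fullv)%VS by rewrite eqEdim sub.
have : f \in (amull e @: fullv)%VS.
  by rewrite E; apply/memv_imgP; exists f; rewrite ?memvf // lfunE /= e'f.
move=> /memv_imgP[z _]; rewrite lfunE /= => fE.
by move: f0; rewrite fE -ee -mulrA -fE ef eqxx.
Qed.

Lemma von_neumann_regular (a : A) : exists z, a = a * z * a.
Proof.
pose Y := limg (amull a).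
have [|e [/memv_imgP[z _ eE] ee eY]] := @right_ideal_principal Y.
  move=> _ b /memv_imgP[z _ ->]; apply/memv_imgP; exists (z * b); first exact: memvf.
  by rewrite !lfunE /= mulrA.
exists z; have := eY a; rewrite eE lfunE /= => -> //.
by apply/memv_imgP; exists 1; rewrite ?memvf // lfunE /= mulr1.
Qed.

(** The mirror image, with the enlarging idempotents supplied by von Neumann regularity:
    [y1 = y1 * z * y1] makes [z * y1] an idempotent of [Y]. *)
Lemma left_ideal_principal Y : left_ideal Y ->
  exists e, [/\ e \in Y, e * e = e & forall y, y \in Y -> y * e = y].
Proof.
move=> lY; suff H n e : e \in Y -> e * e = e -> (\dim Y - \dim (amulr e @: fullv) < n)%N ->
    exists e, [/\ e \in Y, e * e = e & forall y, y \in Y -> y * e = y].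
  by apply: (H (\dim Y).+1 0); rewrite ?mem0v ?mulr0 //; lia.
elim: n e => // n IH e eY ee de.
have [[y yY ye]|Y1] := pselect (exists2 y, y \in Y & y * e != y); last first.
  exists e; split=> // y yY; apply/eqP/negP => N; apply: Y1.
  by exists y => //; apply/negP.
pose y1 := y - y * e.
have y1e : y1 * e = 0 by rewrite mulrBl -mulrA ee subrr.
have [z y1z] := von_neumann_regular y1.
pose f := z * y1.
have fY : f \in Y by rewrite lY // rpredB // lY.
have ff : f * f = f by rewrite /f -mulrA [y1 * _]mulrA -y1z.
have fe : f * e = 0 by rewrite -mulrA y1e mulr0.
have f0 : f != 0.
  apply: contra ye => /eqP f0; rewrite eq_sym -subr_eq0 -/y1 y1z -mulrA -/f f0.
  by rewrite mulr0.
pose e' := e + f - e * f.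
have e'Y : e' \in Y by rewrite rpredB ?rpredD // lY.
have ee' : e * e' = e by rewrite mulrBr mulrDr ee (mulrA e e) ee addrK.
have fe' : f * e' = f by rewrite mulrBr mulrDr fe ff (mulrA f e) fe mul0r subr0 add0r.
clearbody f => {y1z}.
apply: (IH e') => //; first by rewrite {1}/e' mulrBl mulrDl ee' fe' -mulrA fe'.
suff : (\dim (amulr e @: fullv) < \dim (amulr e' @: fullv) <= \dim Y)%N by lia.
apply/andP; split; last first.
  by apply: dimvS; apply/subvP => _ /memv_imgP[w _ ->]; rewrite lfunE /= lY.
rewrite ltnNge; apply/negP => d.
have sub : (amulr e @: fullv <= amulr e' @: fullv)%VS.
  apply/subvP => _ /memv_imgP[w _ ->]; rewrite lfunE /=.
  by apply/memv_imgP; exists (w * e); rewrite ?memvf // lfunE /= -mulrA ee'.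
have /eqP E : (amulr e @: fullv == amulr e' @: fullv)%VS by rewrite eqEdim sub.
have : f \in (amulr e @: fullv)%VS.
  by rewrite E; apply/memv_imgP; exists f; rewrite ?memvf // lfunE /= fe'.
move=> /memv_imgP[w _]; rewrite lfunE /= => fE.
have fE' : f = f * e by rewrite {1}fE -[in LHS]ee mulrA -fE.
by move: f0; rewrite fE' fe eqxx.
Qed.

End SemiprimeAlgebra.

(** * Ranks of matrices over a semiprime algebra *)

Section MatrixAction.
Variables (k : fieldType) (A : falgType k).

(** Columns are stored as finite functions, which form a vector space over [k], whereas ['cV[A]_t]
    is scaled by [A]. *)
Definition mxact r t (N : 'M[A]_(r, t)) (v : {ffun 'I_t -> A}) : {ffun 'I_r -> A} :=
  [ffun j => (N *m \col_i v i) j 0].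

Fact mxact_linear r t (N : 'M[A]_(r, t)) : linear (mxact N).
Proof.
move=> c v w; apply/ffunP => j; rewrite !ffunE !mxE scaler_sumr -big_split /=.
by apply: eq_bigr => i _; rewrite !mxE !ffunE mulrDr scalerAr.
Qed.

HB.instance Definition _ r t (N : 'M[A]_(r, t)) := GRing.isLinear.Build _ _ _ _ _
  (mxact_linear N).

Lemma col_mxact r t (N : 'M[A]_(r, t)) v :
  \col_j linfun (mxact N) v j = N *m \col_i v i.
Proof. by apply/colP => j; rewrite lfunE mxE ffunE. Qed.

Lemma mxact_mem_lker r t (N : 'M[A]_(r, t)) v :
  (v \in lker (linfun (mxact N))) <-> N *m \col_i v i = 0.
Proof.
rewrite memv_ker -col_mxact; split=> [/eqP -> | e]; first by apply/colP => j; rewrite !mxE ffunE.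
by apply/eqP/ffunP => j; have := congr1 (fun c : 'cV_r => c j 0) e; rewrite !mxE => ->; rewrite ffunE.
Qed.

Lemma col_ffun t (c : 'cV[A]_t) : \col_i ([ffun i => c i 0] : {ffun 'I_t -> A}) i = c.
Proof. by apply/colP => i; rewrite mxE ffunE. Qed.

Lemma col_ffun_inj t (v w : {ffun 'I_t -> A}) :
  \col_i v i = \col_i w i -> v = w.
Proof.
by move=> e; apply/ffunP => i; have := congr1 (fun c : 'cV_t => c i 0) e; rewrite !mxE.
Qed.

Definition ideal_vs (T : {vspace A}) : Prop :=
  forall x a, x \in T -> x * a \in T /\ a * x \in T.

Lemma ideal_mulmx T r t (N : 'M[A]_(r, t)) (c : 'cV[A]_t) :
  ideal_vs T -> (forall i, c i 0 \in T) -> forall j, (N *m c) j 0 \in T.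
Proof.
by move=> iT cT j; rewrite mxE rpred_sum // => i _; apply: (iT _ _ (cT i)).2.
Qed.

Lemma vspace_of_right_ideal (P : A -> Prop) :
  P 0 -> (forall x y, P x -> P y -> P (x + y)) -> (forall x a, P x -> P (x * a)) ->
  exists U : {vspace A}, forall x, x \in U <-> P x.
Proof.
move=> P0 PD PM; apply: vspace_of_pred => // c u v Pu Pv; apply: PD => //.
by rewrite -[u]mulr1 scalerAr; exact: PM.
Qed.

Lemma vspace_of_left_ideal (P : A -> Prop) :
  P 0 -> (forall x y, P x -> P y -> P (x + y)) -> (forall x a, P x -> P (a * x)) ->
  exists U : {vspace A}, forall x, x \in U <-> P x.
Proof.
move=> P0 PD PM; apply: vspace_of_pred => // c u v Pu Pv; apply: PD => //.
by rewrite -[u]mul1r scalerAl; exact: PM.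
Qed.

(* Over a semiprime algebra, this is equivalent to [1%:M : 'M_u] being of the form [x *m N *m y]. *)
Definition rank_ge u r t (N : 'M[A]_(r, t)) : Prop :=
  forall T, ideal_vs T ->
    (u * \dim T <= \dim (linfun (mxact N) @: power_vspace t T))%N.

(** Every matrix maps columns with entries in the ideal [T] to such columns, so [x] maps the image
    of the [T]-columns under [N] onto all [T]-columns of length [u]. *)
Lemma rank_ge_factor u r t (N : 'M[A]_(r, t)) (x : 'M_(u, r)) (y : 'M_(t, u)) :
  x *m N *m y = 1%:M -> rank_ge u N.
Proof.
move=> xNy T iT; rewrite -dim_power_vspace.
have sub : (power_vspace u T <=
    linfun (mxact x) @: (linfun (mxact N) @: power_vspace t T))%VS.
  apply/subvP => v /mem_power_vspace vT.
  pose w : {ffun 'I_t -> A} := [ffun i => (y *m \col_i v i) i 0].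
  have -> : v = linfun (mxact x) (linfun (mxact N) w).
    by apply: col_ffun_inj; rewrite !col_mxact col_ffun !mulmxA xNy mul1mx.
  do 2 apply: memv_img; apply/mem_power_vspace => i; rewrite ffunE.
  by apply: ideal_mulmx => // j; rewrite mxE.
apply: leq_trans (dimvS sub) _.
by rewrite -(limg_ker_dim (linfun (mxact x)) (_ @: _)%VS) leq_addl.
Qed.

(** On a column [(a0, b)] the matrix [row_mx phi N] takes the value
    [phi (a0 - C b) + (N + phi C) b], and the first term stays in a space of dimension at most
    [\dim T]. *)
Lemma rank_ge_drop_col u r t (phi : 'cV[A]_r) (N : 'M[A]_(r, t)) (C : 'rV[A]_t) :
  rank_ge u.+1 (row_mx phi N) -> rank_ge u (N + phi *m C).
Proof.
move=> rk T iT; have := rk T iT.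
have sub : (linfun (mxact (row_mx phi N)) @: power_vspace (1 + t) T <=
    linfun (mxact phi) @: power_vspace 1 T +
    linfun (mxact (N + phi *m C)) @: power_vspace t T)%VS.
  apply/subvP => _ /memv_imgP[w /mem_power_vspace wT ->].
  pose c : 'cV_(1 + t) := \col_i w i.
  have cT i : c i 0 \in T by rewrite mxE.
  pose a : {ffun 'I_1 -> A} := [ffun i => (usubmx c - C *m dsubmx c) i 0].
  pose b : {ffun 'I_t -> A} := [ffun i => dsubmx c i 0].
  have -> : linfun (mxact (row_mx phi N)) w =
      linfun (mxact phi) a + linfun (mxact (N + phi *m C)) b.
    apply: col_ffun_inj.
    have -> : \col_j (linfun (mxact phi) a + linfun (mxact (N + phi *m C)) b) j =
       \col_j linfun (mxact phi) a j + \col_j linfun (mxact (N + phi *m C)) b j.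
      by apply/colP => j; rewrite !mxE ffunE.
    rewrite !col_mxact !col_ffun -/c -[in LHS](vsubmxK c) mul_row_col mulmxBr mulmxDl.
    by rewrite -(mulmxA phi) addrACA addNr addr0.
  apply: memv_add; apply: memv_img; apply/mem_power_vspace => i; rewrite ffunE.
    by rewrite !mxE rpredB // rpred_sum // => j _; apply: (iT _ _ _).2; rewrite !mxE.
  by rewrite !mxE.
move=> le1; have {le1 sub} := leq_trans le1 (leq_trans (dimvS sub) (dimv_add_leqif _ _).1).
have : (\dim (linfun (mxact phi) @: power_vspace 1 T) <= \dim T)%N.
  rewrite -[leqRHS]mul1n -dim_power_vspace.
  by rewrite -(limg_ker_dim (linfun (mxact phi))) leq_addl.
by rewrite mulSn; lia.
Qed.


Hypothesis Asp : semiprime A.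

(* [C] minimizes the dimension of the kernel. Then the entries of the kernel vectors lie in
   a two-sided ideal [T0] such that [phi *m x%:M] is in the image already for [x] in [T0]. *)
Lemma rank_ge_improve r t (phi : 'cV[A]_r) (N : 'M[A]_(r, t)) (D P : 'M_t)
    (Q : 'M_(t, r)) (Lam : A -> Prop) :
  Lam 0 -> (forall x y, Lam x -> Lam y -> Lam (x + y)) ->
  (forall x, exists2 c : k, c != 0 & Lam (c *: x)) ->
  P *m D + Q *m N = 1%:M ->
  exists C : 'rV_t, (forall i, Lam (C 0 i)) /\ forall u, (u <= t)%N ->
    rank_ge u (row_mx phi N) -> rank_ge u (N + phi *m C *m D).
Proof.
move=> Lam0 LamD LamZ PDQN.
pose K C := lker (linfun (mxact (N + phi *m C *m D))).
pose good n := `[< exists2 C : 'rV_t, (forall i, Lam (C 0 i)) & \dim (K C) = n >].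
have good0 : exists n, good n.
  exists (\dim (K 0)); apply/asboolP; exists 0 => // i.
  by rewrite mxE.
case: (ex_minnP good0) => n /asboolP[C LamC dC] nmin.
exists C; split=> // u ut rk.
pose N' := N + phi *m C *m D.
(* Carries the left inverse relation over from [N] to [N']; a kernel vector [v] of [N'] is then
   [P' *m (D *m v)]. *)
pose P' := P - Q *m phi *m C.
have P'DQN' : P' *m D + Q *m N' = 1%:M.
  by rewrite -PDQN mulmxBl mulmxDr !mulmxA addrACA addNr addr0.
have [W WP] : exists W : {vspace A}, forall y, y \in W <-> exists v, phi *m y%:M = N' *m v.
  apply: vspace_of_right_ideal.
  - by exists 0; rewrite mulmx0 -scalemx1 scale0r mulmx0.
  - move=> x y [v xE] [w yE]; exists (v + w).
    by rewrite mulmxDr -xE -yE -mulmxDr raddfD.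
  - move=> x a [v xE]; exists (v *m a%:M).
    by rewrite mulmxA -xE -mulmxA -scalar_mxM.
have [|e [eW ee We]] := @right_ideal_principal _ _ Asp W.
  move=> x a /WP[v xE]; apply/WP; exists (v *m a%:M).
  by rewrite mulmxA -xE -mulmxA -scalar_mxM.
have /WP[v0 phie] := eW.
(* [T0] is the largest two-sided ideal inside [W = e A]: it consists of the [x] with [A x] contained
   in [e A]. *)
have [T0 T0P] : exists T0 : {vspace A}, forall x, x \in T0 <-> forall a, (1 - e) * a * x = 0.
  apply: vspace_of_right_ideal.
  - by move=> a; rewrite mulr0.
  - by move=> x y xT yT a; rewrite mulrDr xT yT addr0.
  - by move=> x b xT a; rewrite mulrA xT mul0r.
have iT0 : ideal_vs T0.
  move=> x a /T0P xT; split; apply/T0P => b; first by rewrite mulrA xT mul0r.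
  by rewrite mulrA -[_ * b * a]mulrA xT.
have eT0 x : x \in T0 -> e * x = x.
  by move=> /T0P/(_ 1)/eqP; rewrite mulr1 mulrBl mul1r subr_eq0 => /eqP.
have kerT0 (v : 'cV_t) : N' *m v = 0 -> forall i, v i 0 \in T0.
  move=> N'v; suff DvT : forall i, (D *m v) i 0 \in T0.
    move=> i; have -> : v = P' *m (D *m v).
      by rewrite -[LHS]mul1mx -P'DQN' mulmxDl -!mulmxA N'v mulmx0 addr0.
    exact: ideal_mulmx.
  move=> i; apply: contrapT => /T0P/existsNP[a /eqP Dv0].
  have [l l0 Lam1] := LamZ ((1 - e) * a).
  pose c := l *: ((1 - e) * a).
  have ec : e * c = 0 by rewrite -scalerAr mulrA mulrBr mulr1 ee subrr mul0r scaler0.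
  have cDv : c * (D *m v) i 0 != 0 by rewrite -scalerAl scaler_eq0 negb_or l0.
  pose C' := C + c *: delta_mx 0 i.
  have C'D w : (N + phi *m C' *m D) *m w = N' *m w + phi *m (c * (D *m w) i 0)%:M.
    rewrite /C' mulmxDr mulmxDl addrA mulmxDl; congr (_ + _).
    rewrite -!mulmxA; congr (_ *m _); rewrite -scalemxAl -rowE.
    by apply/rowP => j; rewrite !ord1 !mxE eqxx mulr1n.
  (* Elements of [W] are fixed by [e] on the left, whereas [e * c = 0]. So the new term cannot be
     compensated by [N'] unless it vanishes, and the kernel for [C'] lies inside the old one without
     containing [v]. *)
  have noW w : phi *m (c * (D *m w) i 0)%:M = N' *m (- w) -> c * (D *m w) i 0 = 0.
    move=> h; rewrite -(We (c * _)); last by apply/WP; exists (- w).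
    by rewrite mulrA ec mul0r.
  suff : (\dim (K C') < n)%N.
    rewrite ltnNge => /negP; apply; apply: nmin; apply/asboolP; exists C' => // j.
    rewrite !mxE; apply: LamD => //.
    case: (_ && _) => /=; rewrite ?mulr1 ?mulr0 //.
  have KC' (w : 'cV_t) : (N + phi *m C' *m D) *m w = 0 -> N' *m w = 0 /\ c * (D *m w) i 0 = 0.
    rewrite C'D => /eqP; rewrite addrC addr_eq0 => /eqP h.
    have h0 : c * (D *m w) i 0 = 0 by apply: noW; rewrite h mulmxN.
    split=> //; apply/eqP; rewrite -oppr_eq0 -h h0.
    by rewrite -scalemx1 scale0r mulmx0.
  rewrite -dC ltn_neqAle dimvS ?andbT; last first.
    by apply/subvP => w /mxact_mem_lker/KC'[h _]; apply/mxact_mem_lker.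
  apply/eqP => dE.
  have KE : K C' = K C.
    apply/eqP; rewrite eqEdim dE leqnn andbT.
    by apply/subvP => w /mxact_mem_lker/KC'[h _]; apply/mxact_mem_lker.
  have : [ffun j => v j 0] \in K C by apply/mxact_mem_lker; rewrite col_ffun.
  rewrite -KE => /mxact_mem_lker; rewrite col_ffun => /KC'[_ h].
  by rewrite h eqxx in cDv.
(* The kernel of [N'] is the same on [T]-columns and on [T1]-columns. Rank-nullity on both bounds
   the image below by [t * (\dim T - \dim T1) + u * \dim T1], which is at least [u * \dim T] because
   [u <= t]. *)
move=> T iT; set T1 := (T :&: T0)%VS.
have iT1 : ideal_vs T1.
  move=> x a /memv_capP[xT xT0]; have [? ?] := iT _ a xT; have [? ?] := iT0 _ a xT0.
  by split; apply/memv_capP.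
have T1T : (T1 <= T)%VS by exact: capvSl.
have sub : (linfun (mxact (row_mx phi N)) @: power_vspace (1 + t) T1 <=
    linfun (mxact N') @: power_vspace t T1)%VS.
  apply/subvP => _ /memv_imgP[w /mem_power_vspace wT ->].
  pose c : 'cV_(1 + t) := \col_i w i.
  have cT i : c i 0 \in T1 by rewrite mxE.
  pose d := dsubmx c.
  have dT i : d i 0 \in T1 by rewrite mxE.
  pose y := c (lshift t 0) 0 - (C *m D *m d) 0 0.
  have yT : y \in T1 by rewrite rpredB ?cT // ideal_mulmx.
  have cE : usubmx c = y%:M + C *m D *m d.
    by apply/rowP => j; rewrite !ord1 [usubmx c 0 0]mxE [RHS]mxE [y%:M 0 0]mxE eqxx mulr1n subrK.
  have phiy : phi *m y%:M = N' *m (v0 *m y%:M).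
    rewrite mulmxA -phie -mulmxA -scalar_mxM eT0 //.
    by case/memv_capP: yT.
  apply/memv_imgP; exists [ffun i => (v0 *m y%:M + d) i 0].
    apply/mem_power_vspace => i; rewrite ffunE mxE rpredD //.
    by apply: ideal_mulmx => // j; rewrite !ord1 mxE eqxx mulr1n.
  apply: col_ffun_inj; rewrite !col_mxact col_ffun -/c.
  rewrite -[in LHS](vsubmxK c) mul_row_col cE -/d !mulmxDr phiy -addrA; congr (_ + _).
  by rewrite /N' mulmxDl !mulmxA addrC.
have := dimvS sub; have := rk _ iT1.
have := limg_ker_dim (linfun (mxact N')) (power_vspace t T).
have := limg_ker_dim (linfun (mxact N')) (power_vspace t T1).
have -> : (power_vspace t T :&: lker (linfun (mxact N')) =
          power_vspace t T1 :&: lker (linfun (mxact N')))%VS.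
  apply/vspaceP => w; rewrite !memv_cap.
  case kw : (w \in lker _); rewrite ?andbF // !andbT.
  apply/idP/idP => /mem_power_vspace h; apply/mem_power_vspace => i.
    apply/memv_capP; split=> //.
    by move/mxact_mem_lker: kw => /kerT0/(_ i); rewrite mxE.
  by case/memv_capP: (h i).
rewrite !dim_power_vspace; have := dimvS T1T.
rewrite -/N'; move: (\dim _) (\dim T) (\dim T1) (\dim _) (\dim _) (\dim _) => *; nia.
Qed.

(** Induction on [u]. The left ideal of first entries is generated by an idempotent [e]; every row
    in [P] kills the column [(1 - e, 0)], so [e = 1] and some row [(1, p1)] is in [P]. Subtracting
    its multiples leaves rows with first entry 0. *)
Lemma row_submodule_full u (P : 'rV[A]_u -> Prop) :
  P 0 -> (forall p q, P p -> P q -> P (p + q)) -> (forall a p, P p -> P (a *: p)) ->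
  (forall v : 'cV_u, (forall p, P p -> p *m v = 0) -> v = 0) -> forall q, P q.
Proof.
elim: u P => [|u IH] P; first by move=> P0 _ _ _ q; rewrite thinmx0.
move: P; rewrite -[u.+1]/(1 + u)%N => P P0 PD PZ ann q.
have [L LP] : exists L : {vspace A}, forall x, x \in L <-> exists p', P (row_mx x%:M p').
  apply: vspace_of_left_ideal.
  - by exists 0; rewrite -scalemx1 scale0r row_mx0.
  - move=> x y [p pP] [p' p'P]; exists (p + p').
    by rewrite raddfD -add_row_mx; exact: PD.
  - move=> x a [p pP]; exists (a *: p).
    by rewrite scalar_mxM mul_scalar_mx -scale_row_mx; exact: PZ.
have [|e [/LP[p1 p1P] ee Le]] := @left_ideal_principal _ _ Asp L.
  move=> x a /LP[p pP]; apply/LP; exists (a *: p).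
  by rewrite scalar_mxM mul_scalar_mx -scale_row_mx; exact: PZ.
have rowE (p : 'rV[A]_(1 + u)) : p = row_mx (p 0 (lshift u 0))%:M (rsubmx p).
  rewrite -[LHS]hsubmxK; congr row_mx.
  by apply/rowP => j; rewrite !ord1 !mxE eqxx mulr1n.
have e1 : e = 1.
  have : col_mx (1 - e)%:M 0 = 0 :> 'cV[A]_(1 + u).
    apply: ann => p Pp; rewrite {1}(rowE p) mul_row_col mulmx0 addr0 -scalar_mxM.
    rewrite mulrBr mulr1 Le ?subrr ?raddf0 //; apply/LP; exists (rsubmx p).
    by rewrite -rowE.
  move=> /(congr1 usubmx); rewrite col_mxKu => /rowP/(_ 0).
  by rewrite !mxE eqxx mulr1n => /eqP; rewrite subr_eq0 => /eqP.
rewrite {}e1 {ee Le} in p1P.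
have full' : forall q', P (row_mx 0 q').
  apply: IH.
  - by rewrite row_mx0.
  - by move=> p p' pP p'P; rewrite -[0]addr0 -add_row_mx; exact: PD.
  - by move=> a p pP; rewrite -[0](scaler0 _ a) -scale_row_mx; exact: PZ.
  move=> v' annv'.
  have : col_mx (- (p1 *m v')) v' = 0.
    apply: ann => p Pp.
    set x := p 0 (lshift u 0).
    have : P (p + (- x) *: row_mx 1%:M p1) by apply: PD => //; exact: PZ.
    rewrite {1}(rowE p) scale_row_mx add_row_mx scalemx1 -raddfD addrN raddf0.
    move=> /annv'; rewrite mulmxDl -scalemxAl => h.
    by rewrite (rowE p) mul_row_col mul_scalar_mx scalerN -scaleNr addrC.
  by move=> /(congr1 dsubmx); rewrite col_mxKd => ->; rewrite linear0.
rewrite (rowE q); set x := q 0 _.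
have -> : row_mx x%:M (rsubmx q) = x *: row_mx 1%:M p1 + row_mx 0 (rsubmx q - x *: p1).
  by rewrite scale_row_mx add_row_mx addr0 addrC subrK scalemx1.
by apply: PD => //; exact: PZ.
Qed.

Lemma injective_left_inverse r u (N : 'M[A]_(r, u)) :
  (forall v : 'cV_u, N *m v = 0 -> v = 0) -> exists x, x *m N = 1%:M.
Proof.
move=> injN; have rowN : forall q : 'rV_u, exists z, z *m N = q.
  apply: row_submodule_full.
  - by exists 0; rewrite mul0mx.
  - by move=> p q [z <-] [w <-]; exists (z + w); rewrite mulmxDl.
  - by move=> a p [z <-]; exists (a *: z); rewrite scalemxAl.
  - move=> v annv; apply: injN; apply/row_matrixP => i; rewrite row_mul row0.
    by apply: annv; exists (delta_mx 0 i); rewrite rowE.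
have [z zP] := choice (fun i : 'I_u => rowN (row i 1%:M)).
exists (\matrix_i z i); apply/row_matrixP => i.
by rewrite row_mul rowK zP.
Qed.

(** Converse of [rank_ge_factor]. Columns are merged into the others by [rank_ge_improve] with
    [D = 1] until [u] of them remain; the bound for [T = A] then makes [N] injective by
    dimension. *)
Lemma rank_ge_exists_factor u r t (N : 'M[A]_(r, t)) : rank_ge u N ->
  exists (x : 'M_(u, r)) (y : 'M_(t, u)), x *m N *m y = 1%:M.
Proof.
have iA : ideal_vs (fullv : {vspace A}) by move=> x a _; rewrite !memvf.
have dA : (0 < \dim (fullv : {vspace A}))%N.
  rewrite lt0n dimv_eq0; apply/eqP => h; have := memvf (1 : A).
  by rewrite h memv0 oner_eq0.
move=> rk; have ut : (u <= t)%N.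
  have := rk _ iA; have := limg_ker_dim (linfun (mxact N)) (power_vspace t fullv).
  by rewrite dim_power_vspace => *; rewrite -(leq_pmul2r dA); lia.
rewrite -(subnK ut) in N rk *; elim: (t - u)%N N rk => {ut t} [|n IH].
  rewrite add0n => N rk; suff [x xN] : exists x, x *m N = 1%:M by exists x, 1%:M; rewrite mulmx1.
  apply: injective_left_inverse => v Nv.
  have := rk _ iA; have := limg_ker_dim (linfun (mxact N)) (power_vspace u fullv).
  rewrite dim_power_vspace => h1 h2.
  have k0 : (power_vspace u fullv :&: lker (linfun (mxact N)))%VS = 0%VS.
    apply/eqP; rewrite -dimv_eq0 -leqn0; move: h2; rewrite -h1.
    by rewrite -[leqRHS]add0n leq_add2r.
  have : [ffun i => v i 0] \in (power_vspace u fullv :&: lker (linfun (mxact N)))%VS.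
    apply/memv_capP; split; first by apply/mem_power_vspace => i; rewrite memvf.
    by apply/mxact_mem_lker; rewrite col_ffun.
  rewrite k0 memv0 => /eqP/ffunP h; apply/colP => i.
  by have := h i; rewrite !ffunE mxE.
rewrite -[(n.+1 + u)%N]/(1 + (n + u))%N => N rk.
have [] := @rank_ge_improve r (n + u) (lsubmx N) (rsubmx N) 1%:M 1%:M 0 (fun=> True) => //.
- by move=> x; exists 1; rewrite ?oner_eq0.
- by rewrite mulmx1 mul0mx addr0.
move=> C [_ /(_ u (leq_addl _ _))]; rewrite hsubmxK => /(_ rk)/IH[x [y xy]].
exists x, (col_mx C 1%:M *m y); rewrite -xy !mulmxA; congr (_ *m _).
by rewrite -[in LHS](hsubmxK N) -!mulmxA mul_row_col !mulmx1 addrC.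
Qed.

End MatrixAction.

(** * Semisimple models of localizations *)

Local Open Scope quotient_scope.
Local Open Scope classical_set_scope.
Local Open Scope ring_scope.

Lemma rmorphism_of_fun (R R' : pzRingType) (f : R -> R') :
  f 1 = 1 -> (forall x y, f (x + y) = f x + f y) ->
  (forall x y, f (x * y) = f x * f y) -> exists g : {rmorphism R -> R'}, g =1 f.
Proof.
move=> f1 fD fM.
have f0 : f 0 = 0 by apply: (addrI (f 0)); rewrite -fD !addr0.
have fB : zmod_morphism f.
  by move=> x y; apply: (addIr (f y)); rewrite -fD !subrK.
pose g : {rmorphism R -> R'} := HB.pack f (GRing.isZmodMorphism.Build R R' f fB)
  (GRing.isMonoidMorphism.Build R R' f (f1, fM)).
by exists g.
Qed.

Lemma quotient_field (R : comNzRingType) (I : set R) : ideal I -> ~ I 1 ->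
  (forall x, ~ I x -> exists y, I (y * x - 1)) ->
  exists (k : fieldType) (f : {rmorphism R -> k}),
    (forall z, exists x, f x = z) /\ forall x, f x = 0 <-> I x.
Proof.
move=> [I0 ID IM] I1 Imax.
pose b : {pred R} := fun x => `[< I x >].
have bcl : idealr_closed b.
  split; [exact/asboolP | exact/asboolP |] => a x y /asboolP xI /asboolP yI.
  by apply/asboolP; apply: ID => //; exact: IM.
pose J : idealr R := HB.pack b (isIdealr.Build R b bcl).
pose Q : comNzRingType := {ideal_quot J}.
pose f : R -> Q := \pi_{ideal_quot J}.
have fD x y : f (x + y) = f x + f y by exact: raddfD.
have fM x y : f (x * y) = f x * f y by exact: rmorphM.
have f1 : f 1 = 1 by exact: rmorph1.
have f0 x : f x = 0 <-> I x.
  have f00 : f 0 = 0 by exact: raddf0.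
  rewrite -f00; split=> [/eqP|xI].
    by rewrite /f -Quotient.idealrBE subr0 => /asboolP.
  by apply/eqP; rewrite /f -Quotient.idealrBE subr0; exact/asboolP.
have fsurj (z : Q) : exists x, f x = z by exists (repr z); rewrite /f reprK.
clearbody f.
have inv_ex (z : Q) : exists y, (z = 0 -> y = 0) /\ (z != 0 -> y * z = 1).
  have [->|z0] := eqVneq z 0; first by exists 0; split=> // /eqP.
  have [x fx] := fsurj z.
  have [|y /f0] := Imax x; first by move=> /f0 x0; rewrite fx in x0; move/eqP: z0; rewrite x0.
  have fN1 : f (-1) = -1 by apply: (addIr (f 1)); rewrite -fD addNr f1 addNr; apply/f0.
  rewrite fD fM fx fN1 => /eqP; rewrite subr_eq0 => /eqP yz.
  by exists (f y); split=> // zz; move/eqP: z0; rewrite zz.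
have [inv invP] := choice inv_ex.
have mulV (z : Q) : z != 0 -> inv z * z = 1 by exact: (invP z).2.
have inv0 : inv 0 = 0 by exact: (invP 0).1.
pose k : fieldType := HB.pack {ideal_quot J}
  (GRing.ComNzRing_isField.Build {ideal_quot J} mulV inv0).
have [g gE] := @rmorphism_of_fun R k f f1 fD fM.
exists k, g; split=> [z|x]; first by have [x <-] := fsurj z; exists x.
by rewrite gE; exact: f0.
Qed.

(** The quotient of the local ring by the fractions with numerator in [p]. Only the map from [S] is
    kept, with the fact that every element of [k] is a fraction. *)
Lemma residue_field (S : comPzRingType) (p : spec S) :
  exists (k : fieldType) (f : {rmorphism S -> k}),
    (forall s, f s = 0 <-> spec_set p s) /\
    (forall z, exists a s, ~ spec_set p s /\ f s * z = f a).
Proof.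
have pP := spec_prime p; case: (pP) => -[p0 pD pM] p1 pI.
have mulE (b c : S) (s t : denom p) :
    (loc_frac (b : S^o) s : loc_ring p) * loc_frac (c : S^o) t =
    loc_frac (b * c : S^o) (denomM s t) by exact: loc_scaleE.
have addE (b c : S) (s t : denom p) :
    (loc_frac (b : S^o) s : loc_ring p) + loc_frac (c : S^o) t =
    loc_frac (sval t * b + sval s * c : S^o) (denomM s t) by exact: loc_addE.
have denP (s : denom p) : ~ spec_set p (sval s) by case: s => s /=; rewrite inE.
have fracP (b c : S) (s t : denom p) : spec_set p b ->
    loc_frac (b : S^o) s = loc_frac (c : S^o) t -> spec_set p c.
  move=> pb /eq_loc_frac[u]; rewrite /GRing.scale /= => e.
  have : spec_set p (sval u * (sval s * c)) by rewrite -e; apply: (pM); exact: (pM).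
  by case/pI => [/denP//|/pI[/denP//|]].
have nz : (1 : loc_ring p) != 0.
  apply/eqP => /esym h; apply: p1; exact: (fracP 0 1 (denom1 p) (denom1 p) p0 h).
pose R : comNzRingType := HB.pack (loc_ring p)
  (GRing.PzSemiRing_isNonZero.Build (loc_ring p) nz).
pose I : set R := [set x | exists2 b : S, spec_set p b & exists s, x = loc_frac (b : S^o) s].
have oppE (b : S) (s : denom p) : - (loc_frac (b : S^o) s : loc_ring p) = loc_frac (- b : S^o) s.
  exact: loc_oppE.
have [||| k [g [gs g0]]] := @quotient_field R I.
- split.
  + by exists 0 => //; exists (denom1 p).
  + move=> _ _ [b pb [s ->]] [c pc [t ->]].
    by exists (sval t * b + sval s * c); [apply: pD; apply: pM|exists (denomM s t); exact: addE].
  + move=> x _ [b pb [s ->]]; have [a [t ->]] := loc_fracP x.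
    by exists ((a : S) * b); [exact: pM|exists (denomM t s); exact: mulE].
- by move=> [b pb [s]] /esym h; apply: p1; exact: (fracP _ _ _ (denom1 p) pb h).
- move=> x; have [a [t ->]] := loc_fracP x => nI.
  have na : (a : S) \in ~` spec_set p by rewrite inE => pa; apply: nI; exists a => //; exists t.
  pose a' : denom p := exist _ (a : S) na.
  exists (loc_frac (sval t : S^o) a' : loc_ring p).
  have -> : (loc_frac (sval t : S^o) a' : R) * loc_frac a t - 1 = 0.
    apply/eqP; rewrite subr_eq0; apply/eqP.
    transitivity (loc_frac (sval t * a : S^o) (denomM a' t)); first exact: mulE.
    apply/eq_loc_frac; exists (denom1 p); rewrite /= /GRing.scale /=; ring.
  by exists 0 => //; exists (denom1 p).
pose f s := g (loc_frac (s : S^o) (denom1 p)).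
have [h hE] : exists h : {rmorphism S -> k}, h =1 f.
  apply: rmorphism_of_fun.
  - exact: (rmorph1 g).
  - move=> x y; rewrite /f -rmorphD; congr (g _); rewrite [RHS]addE.
    by apply/eq_loc_frac; exists (denom1 p); rewrite /= /GRing.scale /=; ring.
  - move=> x y; rewrite /f -rmorphM; congr (g _); rewrite [RHS]mulE.
    by apply/eq_loc_frac; exists (denom1 p); rewrite /= /GRing.scale /=; ring.
exists k, h; split.
  move=> s; rewrite hE /f g0; split=> [[b pb [t /esym/fracP]]|ps]; first exact.
  by exists s => //; exists (denom1 p).
move=> z; have [x <-] := gs z; have [a [s ->]] := loc_fracP x.
exists (a : S), (sval s); split; first exact: denP.
rewrite !hE /f -rmorphM; congr (g _); rewrite [LHS]mulE.
by apply/eq_loc_frac; exists (denom1 p); rewrite /= /GRing.scale /=; ring.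
Qed.

(** * Elements outside a prime as denominators *)

Section PrimeIdeals.
Variables (S : comPzRingType) (p : spec S).

Lemma prime0 : spec_set p 0. Proof. by case: (spec_prime p) => -[]. Qed.

Lemma primeD x y : spec_set p x -> spec_set p y -> spec_set p (x + y).
Proof. by case: (spec_prime p) => -[_ + _] _ _; apply. Qed.

Lemma primeMl x y : spec_set p y -> spec_set p (x * y).
Proof. by case: (spec_prime p) => -[_ _ +] _ _; apply. Qed.

Lemma prime1 : ~ spec_set p 1. Proof. by case: (spec_prime p). Qed.

Lemma notin_primeM x y : ~ spec_set p x -> ~ spec_set p y -> ~ spec_set p (x * y).
Proof. by move=> px py; case: (spec_prime p) => _ _ /[apply] -[]. Qed.

Lemma notin_prime_prod (I : finType) (f : I -> S) :
  (forall i, ~ spec_set p (f i)) -> ~ spec_set p (\prod_i f i).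
Proof.
by move=> fp; apply: (big_ind (fun s => ~ spec_set p s)) => //;
  [exact: prime1 | exact: notin_primeM].
Qed.

(** The product of the individual denominators works. This stands in for computing in a
    localization. *)
Lemma common_denominator (I : finType) (Q : I -> S -> Prop) :
  (forall i s t, Q i s -> Q i (t * s)) ->
  (forall i, exists2 s, ~ spec_set p s & Q i s) ->
  exists2 s, ~ spec_set p s & forall i, Q i s.
Proof.
move=> QM exQ.
have [f fP] := choice (fun i => match exQ i with ex_intro2 s a b => ex_intro _ s (conj a b) end).
exists (\prod_i f i); first by apply: notin_prime_prod => i; case: (fP i).
by move=> i; rewrite (bigD1 i) //= mulrC; apply: QM; case: (fP i).
Qed.

End PrimeIdeals.

(** * The determinant trick *)

Lemma nontrivial_rmorphism (S : comPzRingType) (E : pzRingType) (f : {rmorphism S -> E})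
    (nz : (1 : S) != 0) :
  let R : comNzRingType := HB.pack S (GRing.PzSemiRing_isNonZero.Build S nz) in
  exists g : {rmorphism R -> E}, forall s : S, g s = f s.
Proof.
move=> R; apply: (@rmorphism_of_fun R E f); first exact: (rmorph1 f).
  by move=> x y; exact: (rmorphD f).
by move=> x y; exact: (rmorphM f).
Qed.

(** By Cayley-Hamilton, the characteristic polynomial of [a] evaluated at [x] kills every [e j]. Up
    to sign its constant coefficient is [\det a], and the other terms make up [q * x]. *)
Lemma determinant_trick_nz (R : comNzRingType) (E : pzRingType) (iota : {rmorphism R -> E})
    (n : nat) (e : 'I_n.+1 -> E) (x : E) (a : 'M[R]_n.+1) :
  (forall s y, iota s * y = y * iota s) ->
  (forall j, x * e j = \sum_i iota (a i j) * e i) ->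
  exists q, forall j, (iota (\det a) + q * x) * e j = 0.
Proof.
move=> iC xe.
have powE m j : x ^+ m * e j = \sum_i iota ((a ^+ m) i j) * e i.
  elim: m j => [|m IH] j.
    rewrite !expr0 mul1r (bigD1 j) //= mxE eqxx rmorph1 mul1r big1 ?addr0 // => i ij.
    by rewrite mxE (negPf ij) rmorph0 mul0r.
  rewrite exprSr -mulrA xe mulr_sumr.
  under eq_bigr => i _.
    rewrite mulrA -iC -mulrA IH mulr_sumr; over.
  rewrite exchange_big /=; apply: eq_bigr => l _.
  rewrite exprSr -[_ * a]/(_ *m a) mxE rmorph_sum mulr_suml.
  by apply: eq_bigr => i _; rewrite mulrA -rmorphM [a i j * _]mulrC.
pose chi := char_poly a.
have chiE j : \sum_(i < size chi) iota chi`_i * x ^+ i * e j = 0.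
  transitivity (\sum_l iota ((horner_mx a chi) l j) * e l); last first.
    by rewrite Cayley_Hamilton big1 // => l _; rewrite mxE rmorph0 mul0r.
  under eq_bigr => i _ do rewrite -mulrA powE mulr_sumr.
  rewrite exchange_big /=; apply: eq_bigr => l _.
  have -> : horner_mx a chi = \sum_(i < size chi) chi`_i *: a ^+ i.
    rewrite /horner_mx /horner_morph (@horner_coef_wide _ (size chi)) ?size_poly //.
    by apply: eq_bigr => i _; rewrite coef_map -mul_scalar_mx.
  rewrite summxE rmorph_sum mulr_suml; apply: eq_bigr => i _.
  by rewrite mxE rmorphM mulrA.
have sz : size chi = n.+2 by rewrite size_char_poly.
pose q := \sum_(i < n.+1) iota chi`_i.+1 * x ^+ i.
exists ((-1) ^+ n.+1 * q) => j; move: (chiE j); rewrite sz big_ord_recl /=.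
have -> : chi`_0 = (-1) ^+ n.+1 * \det a by rewrite -char_poly_det.
rewrite expr0 mulr1.
under eq_bigr => i _ do rewrite [in x ^+ _]/bump /= add1n exprSr mulrA.
rewrite -mulr_suml -mulr_suml -/q -mulrDl => h.
have -> : iota (\det a) + (-1) ^+ n.+1 * q * x =
    (-1) ^+ n.+1 * (iota ((-1) ^+ n.+1 * \det a) + q * x).
  by rewrite mulrDr rmorphM rmorph_sign mulrA -expr2 sqrr_sign mul1r mulrA.
by rewrite -mulrA h mulr0.
Qed.

Lemma determinant_trick (S : comPzRingType) (E : pzRingType) (iota : {rmorphism S -> E})
    (n : nat) (e : 'I_n.+1 -> E) (x : E) (a : 'M[S]_n.+1) : (1 : S) != 0 ->
  (forall s y, iota s * y = y * iota s) ->
  (forall j, x * e j = \sum_i iota (a i j) * e i) ->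
  exists q, forall j, (iota (\det a) + q * x) * e j = 0.
Proof.
move=> nz iC xe; have [iota' iE] := nontrivial_rmorphism iota nz.
have [||q qP] := @determinant_trick_nz _ E iota' n e x a.
- by move=> s y; rewrite !iE.
- by move=> j; rewrite xe; apply: eq_bigr => i _; rewrite iE.
by exists q => j; rewrite -[RHS](qP j) iE.
Qed.

(** * Representations of the algebra over the residue field *)

Section LocalRepresentation.
Variables (S : comPzRingType) (E : pzRingType) (iota : {rmorphism S -> E}).
Hypothesis iotaC : forall s y, iota s * y = y * iota s.
Hypothesis E_fg : exists N (e : 'I_N -> E), forall x, exists c : 'I_N -> S,
  x = \sum_i iota (c i) * e i.
Variable p : spec S.
Hypothesis iota_p : forall s, iota s = 0 -> spec_set p s.
Variables (k : fieldType) (kappa : {rmorphism S -> k}).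
Hypothesis kappa0 : forall s, kappa s = 0 <-> spec_set p s.
Hypothesis kappa_frac : forall z, exists a s, ~ spec_set p s /\ kappa s * z = kappa a.

Definition spans n (e : 'I_n -> E) : Prop :=
  forall x, exists2 s, ~ spec_set p s & exists c : 'I_n -> S,
    iota s * x = \sum_i iota (c i) * e i.

(** The number of generators is minimal, and a relation with a coefficient outside [p] would
    eliminate one; so they become a basis over the residue field. At least one remains, because
    [iota s = 0] only for [s] in [p]. *)
Lemma minimal_spanning : exists n (e : 'I_n.+1 -> E), spans e /\
  forall c : 'I_n.+1 -> S, \sum_i iota (c i) * e i = 0 -> forall i, spec_set p (c i).
Proof.
have [N [e0 e0P]] := E_fg.
pose good n := `[< exists e : 'I_n -> E, spans e >].
have ex : exists n, good n.
  exists N; apply/asboolP; exists e0 => x; have [c cE] := e0P x.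
  by exists 1; [exact: prime1|exists c; rewrite rmorph1 mul1r].
case: (ex_minnP ex) => -[|n] /asboolP[e eP] nmin.
  have [s ps [c]] := eP 1; rewrite mulr1 big_ord0 => /iota_p.
  by [].
exists n, e; split=> // c c0 i; apply: contrapT => pci.
suff /nmin : good n by rewrite ltnn.
apply/asboolP; exists (e \o lift i) => x; have [s ps [d dE]] := eP x.
exists (c i * s); first exact: notin_primeM.
exists (fun j => c i * d (lift i j) - d i * c (lift i j)).
have : iota (c i * s) * x = \sum_j iota (c i * d j - d i * c j) * e j.
  have -> : iota (c i * s) * x = iota (c i) * (iota s * x) -
      iota (d i) * \sum_j iota (c j) * e j.
    by rewrite c0 mulr0 subr0 rmorphM mulrA.
  rewrite dE !mulr_sumr -sumrB; apply: eq_bigr => j _.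
  by rewrite !mulrA -!rmorphM -mulrBl -rmorphB.
move=> ->; rewrite (bigD1_ord i) //= mulrC subrr rmorph0 mul0r add0r.
by apply: eq_bigr => j _.
Qed.

Definition unit_detecting n (rho : E -> 'M[k]_n.+1) : Prop :=
  forall x, rho x \in unitmx -> exists y s, ~ spec_set p s /\ y * x = iota s.

Definition matrix_rep n (rho : E -> 'M[k]_n.+1) : Prop :=
  [/\ forall x y, rho (x + y) = rho x + rho y,
      forall x y, rho (x * y) = rho x *m rho y,
      forall s, rho (iota s) = (kappa s)%:M & unit_detecting rho].

Lemma kappa_neq0 s : ~ spec_set p s -> kappa s != 0.
Proof. by move=> ps; apply/eqP => /kappa0. Qed.

(** Left multiplication on the fibre of [E] over the residue field, in the basis [e]. With
    denominators it is a relation [R], single-valued because relations among the [e i] have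
    coefficients in [p]. If [rho x] is invertible then [\det a] is outside [p], and the determinant
    trick gives a left inverse of [x] up to a denominator. *)
Lemma exists_matrix_rep : exists n (rho : E -> 'M[k]_n.+1), matrix_rep rho.
Proof.
have [n [e [eP eI]]] := minimal_spanning; exists n.
pose R x (M : 'M[k]_n.+1) := exists s (a : 'M[S]_n.+1), [/\ ~ spec_set p s,
  forall j, iota s * x * e j = \sum_i iota (a i j) * e i & kappa s *: M = map_mx kappa a].
have eqI (a b : 'I_n.+1 -> S) : \sum_i iota (a i) * e i = \sum_i iota (b i) * e i ->
    forall i, kappa (a i) = kappa (b i).
  move=> ab i; apply/eqP; rewrite -subr_eq0 -rmorphB; apply/eqP/kappa0.
  apply: (eI (fun i => a i - b i)).
  under eq_bigr => j _ do rewrite rmorphB mulrBl.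
  by rewrite sumrB ab subrr.
have Rfun x M M' : R x M -> R x M' -> M = M'.
  move=> [s [a [ps aE aM]]] [t [b [pt bE bM]]].
  have st0 : kappa (s * t) != 0 by apply/kappa_neq0/notin_primeM.
  apply: (scalerI st0); rewrite rmorphM mulrC -scalerA aM mulrC -scalerA bM.
  apply/matrixP => i j; rewrite !mxE -!rmorphM.
  apply: (eqI (fun i => t * a i j) (fun i => s * b i j)).
  transitivity (iota (s * t) * x * e j).
    rewrite mulrC rmorphM -!mulrA [iota s * _]mulrA aE mulr_sumr.
    by apply: eq_bigr => l _; rewrite rmorphM mulrA.
  rewrite rmorphM -!mulrA [iota t * _]mulrA bE mulr_sumr.
  by apply: eq_bigr => l _; rewrite rmorphM mulrA.
have Rtot x : exists M, R x M.
  have [|j|s ps sP] := @common_denominator S p 'I_n.+1 (fun j s =>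
      exists c : 'I_n.+1 -> S, iota s * x * e j = \sum_i iota (c i) * e i).
  - move=> j s t [c cE]; exists (fun i => t * c i).
    rewrite rmorphM -!mulrA [iota s * _]mulrA cE mulr_sumr.
    by apply: eq_bigr => i _; rewrite rmorphM mulrA.
  - by have [s ps [c cE]] := eP (x * e j); exists s => //; exists c; rewrite -mulrA.
  have [c cP] := choice sP.
  exists ((kappa s)^-1 *: map_mx kappa (\matrix_(i, j) c j i)).
  exists s, (\matrix_(i, j) c j i); split => //.
    by move=> j; rewrite cP; apply: eq_bigr => i _; rewrite mxE.
  by rewrite scalerA divff ?kappa_neq0 // scale1r.
have [rho rhoP] := choice Rtot; exists rho; split.
- move=> x y; apply: Rfun (rhoP _) _.
  have [s [a [ps aE aM]]] := rhoP x; have [t [b [pt bE bM]]] := rhoP y.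
  exists (s * t), (t *: a + s *: b); split; first exact: notin_primeM.
    move=> j.
    have -> : iota (s * t) * (x + y) * e j =
        iota t * (iota s * x * e j) + iota s * (iota t * y * e j).
      by rewrite mulrDr mulrDl !mulrA -!rmorphM [t * s]mulrC.
    rewrite aE bE !mulr_sumr -big_split; apply: eq_bigr => i _ /=.
    by rewrite !mxE rmorphD !rmorphM mulrDl !mulrA.
  rewrite map_mxD !map_mxZ -aM -bM !scalerA scalerDr rmorphM.
  by rewrite [X in _ = X *: _ + _]mulrC.
- move=> x y; apply: Rfun (rhoP _) _.
  have [s [a [ps aE aM]]] := rhoP x; have [t [b [pt bE bM]]] := rhoP y.
  exists (s * t), (a *m b); split; first exact: notin_primeM.
    move=> j; rewrite rmorphM.
    have -> : iota s * iota t * (x * y) * e j = iota s * x * (iota t * y * e j).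
      by rewrite !mulrA -(mulrA _ (iota t) x) (iotaC t) !mulrA.
    rewrite bE mulr_sumr.
    under eq_bigr => i _ do rewrite mulrA -iotaC -mulrA aE mulr_sumr.
    rewrite exchange_big /=; apply: eq_bigr => l _.
    rewrite mxE rmorph_sum mulr_suml; apply: eq_bigr => i _.
    by rewrite mulrA -rmorphM [b i j * _]mulrC.
  by rewrite map_mxM -aM -bM rmorphM -scalemxAl -scalemxAr scalerA.
- move=> s; apply: Rfun (rhoP _) _; exists 1, (s%:M); split; first exact: prime1.
    move=> j; rewrite rmorph1 mul1r (bigD1 j) //= mxE eqxx big1 ?addr0 // => i ij.
    by rewrite mxE (negPf ij) rmorph0 mul0r.
  by rewrite rmorph1 scale1r map_scalar_mx.
- move=> x ux; have [s [a [ps aE aM]]] := rhoP x.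
  have nz : (1 : S) != 0.
    apply/eqP => h; apply: (@prime1 S p); rewrite h; exact: prime0.
  have [q qE] := determinant_trick nz iotaC aE.
  have [s1 ps1 [c cE]] := eP 1.
  have z0 : iota s1 * (iota (\det a) + q * (iota s * x)) = 0.
    rewrite iotaC -[iota s1]mulr1 cE mulr_sumr big1 // => i _.
    by rewrite mulrA -iotaC -mulrA qE mulr0.
  exists (- (iota s1 * q * iota s)), (s1 * \det a); split.
    apply: notin_primeM => // /kappa0; rewrite -det_map_mx -aM detZ.
    by apply/eqP; rewrite mulf_neq0 ?expf_neq0 ?kappa_neq0 // -unitfE -unitmxE.
  rewrite mulNr; apply/esym/eqP; rewrite -addr_eq0 -[X in _ == X]z0 mulrDr rmorphM.
  by rewrite !mulrA.
Qed.

Definition rep_span n (rho : E -> 'M[k]_n.+1) (B : {vspace 'M[k]_n.+1}) : Prop :=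
  forall b, b \in B <-> exists s x, ~ spec_set p s /\ kappa s *: b = rho x.

Lemma matrix_repZ n (rho : E -> 'M[k]_n.+1) : matrix_rep rho ->
  forall s x, rho (iota s * x) = kappa s *: rho x.
Proof. by move=> [_ rM rI _] s x; rewrite rM rI mul_scalar_mx. Qed.

Lemma exists_rep_span n (rho : E -> 'M[k]_n.+1) : matrix_rep rho ->
  exists B, rep_span rho B.
Proof.
move=> rr; case: (rr) => rD rM rI _; apply: vspace_of_pred.
  exists 1, 0; split; first exact: prime1.
  by rewrite scaler0; apply: (addrI (rho 0)); rewrite -rD !addr0.
move=> c u v [s [x [ps xE]]] [t [y [pt yE]]].
have [a [s0 [ps0 cE]]] := kappa_frac c.
exists (s0 * (s * t)), (iota (a * t) * x + iota (s0 * s) * y); split.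
  by do 2![apply: notin_primeM => //].
rewrite rD !(matrix_repZ rr) -xE -yE scalerDr !scalerA !rmorphM -cE.
by congr (_ *: _ + _ *: _); ring.
Qed.

(* [P] projects onto the subspace [W] killed by [J], which is stable under [B] and contains
   the image of [J]; [F] takes the block diagonal part of a matrix with respect to [W]. On
   it [J] vanishes, whereas invertibility is unchanged. *)
Lemma matrix_rep_reduce n (rho : E -> 'M[k]_n.+1) (B J : {vspace 'M[k]_n.+1}) :
  matrix_rep rho -> rep_span rho B -> (J <= B)%VS ->
  (forall j b, j \in J -> b \in B -> j * b \in J /\ b * j \in J) ->
  (forall i j, i \in J -> j \in J -> i * j = 0) -> J != 0%VS ->
  exists (rho' : E -> 'M[k]_n.+1) B',
    [/\ matrix_rep rho', rep_span rho' B' & (\dim B' < \dim B)%N].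
Proof.
move=> rr BP JB JI JJ J0; case: (rr) => rD rM rI rU.
have rB x : rho x \in B.
  by apply/BP; exists 1, x; split; [exact: prime1|rewrite rmorph1 scale1r].
have [W WP] : exists W : {vspace 'rV[k]_n.+1}, forall w, w \in W <->
    forall j, j \in J -> w *m j = 0.
  apply: vspace_of_pred => [j _|c u v uJ vJ j jJ]; first by rewrite mul0mx.
  by rewrite mulmxDl -scalemxAl uJ // vJ // scaler0 addr0.
pose P : 'M[k]_n.+1 := lin1_mx (projv W).
have PE v : v *m P = projv W v by rewrite mul_rV_lin1.
have vPW v : v *m P \in W by rewrite PE memv_proj.
have wP w : w \in W -> w *m P = w by move=> wW; rewrite PE projv_id.
have Pj j : j \in J -> P * j = 0.
  move=> jJ; apply/row_matrixP => i; rewrite -[_ * _]/(_ *m _) row_mul row0 rowE.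
  exact: (WP _).1 (vPW _) j jJ.
have PbP b : b \in B -> P * b * P = P * b.
  move=> bB; apply/row_matrixP => i.
  rewrite -[_ * b * P]/(_ *m P) row_mul -[_ * b]/(_ *m b) row_mul wP //.
  apply/WP => j jJ; rewrite rowE -(mulmxA _ b j).
  exact: (WP _).1 (vPW _) _ (JI j b jJ bB).2.
have jP j : j \in J -> j * P = j.
  move=> jJ; apply/row_matrixP => i; rewrite -[_ * _]/(_ *m _) row_mul wP //.
  by apply/WP => j' j'J; rewrite -row_mul [_ *m _](JJ j j' jJ j'J) row0.
have PP : P * P = P.
  by apply/row_matrixP => i; rewrite -[_ * _]/(_ *m _) row_mul wP // rowE.
(* On [B], where [P * x * P = P * x], this equals [P x P + (1 - P) x (1 - P)]. *)
pose F (x : 'M[k]_n.+1) := x - x * P + P * x.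
have Fl : linear F.
  move=> c x y; rewrite /F mulrDr mulrDl scalerDr scalerBr -scalerAl -scalerAr.
  by rewrite opprD (addrACA (c *: x)); exact: addrACA.
pose FL : {linear 'M[k]_n.+1 -> 'M[k]_n.+1} := HB.pack F (GRing.isLinear.Build _ _ _ _ F Fl).
have FE x : linfun FL x = F x by rewrite lfunE.
exists (F \o rho), (linfun FL @: B)%VS; split.
- split=> /=.
  + by move=> x y; rewrite rD -!FE linearD.
  + move=> x y; rewrite rM; move: (rho x) (rho y) (PbP _ (rB x)) (PbP _ (rB y)) => a b Pa Pb.
    have Pab : P * (a * b) * P = P * (a * b).
      by rewrite mulrA -Pa -(mulrA _ P) -(mulrA _ _ P) Pb.
    rewrite -[_ *m b]/(a * b) -[_ *m F b]/(F a * F b) /F.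
    rewrite !(mulrDl, mulrDr, mulrBl, mulrBr, mulNr, mulrN) opprK !mulrA.
    have aPb : a * P * b * P = a * P * b by rewrite -!mulrA (mulrA P b) Pb.
    have PaPb : P * a * P * b = P * a * b by rewrite Pa.
    have aPPb : a * P * P * b = a * P * b by rewrite -(mulrA a) PP.
    have PabP : P * a * b * P = P * a * b by rewrite -(mulrA P a b) Pab.
    rewrite aPb PaPb aPPb PabP.
    by rewrite subrr add0r addNr add0r addrK.
  + by move=> s; rewrite rI /F -[_ * P]/(_ *m P) -[P * _]/(P *m _) scalar_mxC subrK.
  + move=> x /= ux; apply: rU; move: (rho x) (PbP _ (rB x)) ux => a Pa.
    (* [N] is the off-diagonal part of [a], and [N * V] squares to zero; so [a = (1 + N * V) * U] is
       invertible as soon as [U] is. *)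
    set U := F a => ux; pose N := a * P - P * a.
    pose V := U^-1.
    have UV : U * V = 1 by rewrite divrr.
    have VU : V * U = 1 by rewrite mulVr.
    have aE : a = U + N by rewrite /U /F /N addrACA subrr addr0 subrK.
    have UP : U * P = P * U.
      rewrite /U /F mulrDl mulrDr mulrBl mulrBr -(mulrA a) PP subrr add0r Pa mulrA PP.
      by rewrite mulrA Pa subrr add0r.
    have VP : V * P = P * V.
      by rewrite -[LHS]mulr1 -UV mulrA -(mulrA V) -UP mulrA VU mul1r.
    have NP : N * P = N by rewrite mulrBl -mulrA PP Pa.
    have PN : P * N = 0 by rewrite mulrBr mulrA Pa mulrA PP subrr.
    have NVNV : N * V * (N * V) = 0.
      by rewrite -{1}NP -(mulrA N) -VP -!mulrA (mulrA P) PN mul0r !mulr0.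
    clearbody N U V; suff /mulmx1_unit[] : a *m (V * (1 - N * V)) = 1%:M by [].
    rewrite -[_ *m _]/(a * _) aE mulrA mulrDl UV mulrBr mulr1 mulrDl mul1r NVNV addr0.
    by rewrite addrK.
- move=> b; split=> [/memv_imgP[c /BP[s [x [ps xE]]] ->]|[s [x [ps xE]]]].
    by exists s, x; split=> //; rewrite /= -FE -xE linearZ.
  apply/memv_imgP; exists ((kappa s)^-1 *: rho x); first exact: memvZ.
  by rewrite linearZ /= FE -[F _]xE scalerA mulVf ?scale1r // kappa_neq0.
rewrite -(limg_ker_dim (linfun FL) B) -[ltnLHS]add0n ltn_add2r lt0n dimv_eq0.
apply: contraNneq J0 => K0; rewrite -subv0 -K0.
apply/subvP => j jJ; rewrite memv_cap (subvP JB) // memv_ker FE /F jP // Pj // subrr.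
by rewrite !addr0 eqxx.
Qed.

(** Descent on the dimension of [B]: [matrix_rep_reduce] removes any nonzero square-zero ideal and
    strictly shrinks [B]. *)
Lemma exists_semiprime_rep : exists n (rho : E -> 'M[k]_n.+1) (B : {vspace 'M[k]_n.+1}),
  [/\ matrix_rep rho, rep_span rho B & forall J : {vspace 'M[k]_n.+1}, (J <= B)%VS ->
    (forall j b, j \in J -> b \in B -> j * b \in J /\ b * j \in J) ->
    (forall i j, i \in J -> j \in J -> i * j = 0) -> J = 0%VS].
Proof.
have [n [rho rr]] := exists_matrix_rep; have [B BP] := exists_rep_span rr.
exists n; have [m] := ubnP (\dim B); elim: m rho rr B BP => // m IH rho rr B BP dB.
have [[J [JB JI JJ J0]]|noJ] := pselect (exists J : {vspace 'M[k]_n.+1}, [/\ (J <= B)%VS,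
    forall j b, j \in J -> b \in B -> j * b \in J /\ b * j \in J,
    forall i j, i \in J -> j \in J -> i * j = 0 & J != 0%VS]).
  have [rho' [B' [rr' BP' dB']]] := matrix_rep_reduce rr BP JB JI JJ J0.
  by apply: (IH rho' rr' B' BP'); lia.
exists rho, B; split=> // J JB JI JJ; apply: contrapT => /eqP J0.
by apply: noJ; exists J.
Qed.

(** [A] is the span [B] with its algebra structure. One-sided inverses suffice in the last clause
    because elements of [A] are square matrices over a field. *)
Lemma local_algebra : exists (A : falgType k) (rho : {rmorphism E -> A}),
  [/\ semiprime A, forall s, rho (iota s) = (kappa s)%:A,
      forall a, exists s x, ~ spec_set p s /\ kappa s *: a = rho x &
      forall x z, z * rho x = 1 \/ rho x * z = 1 ->
        exists y s, ~ spec_set p s /\ y * x = iota s].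
Proof.
have [n [rho [B [rr BP noJ]]]] := exists_semiprime_rep.
case: (rr) => rD rM rI rU.
have rB x : rho x \in B.
  by apply/BP; exists 1, x; split; [exact: prime1|rewrite rmorph1 scale1r].
have r1 : rho 1 = 1 by rewrite -(rmorph1 iota) rI rmorph1.
have BB : (B * B <= B)%VS.
  apply/prodvP => a b /BP[s [x [ps xE]]] /BP[t [y [pt yE]]]; apply/BP.
  exists (s * t), (x * y); split; first exact: notin_primeM.
  by rewrite rM -xE -yE rmorphM -scalemxAl -scalemxAr scalerA.
have B1 : 1 \in B by rewrite -r1.
have Ba : is_aspace B by rewrite /is_aspace has_algid1.
pose BA : {aspace 'M[k]_n.+1} := ASpace Ba.
pose A : falgType k := subvs_of BA.
have A1 : vsval (1 : A) = 1 by apply/eqP; rewrite -[X in X == _]/(algid BA) algid_eq1.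
have [r rE] : exists r : {rmorphism E -> A}, r =1 (fun x => vsproj BA (rho x)).
  apply: rmorphism_of_fun => [|x y|x y]; apply: val_inj => /=.
  - by rewrite r1 vsprojK // -[RHS]A1.
  - by rewrite !vsprojK ?rB // rD.
  - by rewrite !vsprojK ?rB // rM.
have vr x : vsval (r x) = rho x by rewrite rE vsprojK ?rB.
exists A, r; split.
- move=> J JA AJ JJ; apply/eqP; rewrite -subv0; apply/subvP => j jJ.
  have J0 : (linfun vsval @: J)%VS = 0%VS.
    apply: noJ.
    + by apply/subvP => _ /memv_imgP[a aJ ->]; rewrite lfunE /= subvsP.
    + move=> _ b /memv_imgP[a aJ ->] bB; rewrite lfunE /=; split.
        apply/memv_imgP; exists (a * vsproj BA b); last by rewrite lfunE /= vsprojK.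
        by apply: (subvP JA); rewrite memv_mul // memvf.
      apply/memv_imgP; exists (vsproj BA b * a); last by rewrite lfunE /= vsprojK.
      by apply: (subvP AJ); rewrite memv_mul // memvf.
    + move=> _ _ /memv_imgP[a aJ ->] /memv_imgP[b bJ ->]; rewrite !lfunE /=.
      have : a * b \in (J * J)%VS by exact: memv_mul.
      by rewrite JJ memv0 => /eqP/(congr1 vsval).
  have : linfun vsval j \in (linfun vsval @: J)%VS by exact: memv_img.
  by rewrite J0 !memv0 lfunE /= => /eqP h; apply/eqP/val_inj.
- move=> s; apply: val_inj; rewrite -[LHS]/(vsval _) vr rI -scalemx1.
  by rewrite -[1%:M]A1.
- move=> a; have /BP[s [x [ps xE]]] := subvsP a.
  by exists s, x; split=> //; apply: val_inj; rewrite -[RHS]/(vsval _) vr -xE.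
- move=> x z h; apply: rU; rewrite -vr.
  case: h => /(congr1 vsval); rewrite A1 => /= h.
    by case: (@mulmx1_unit _ _ (vsval z) (vsval (r x)) h).
  by case: (@mulmx1_unit _ _ (vsval (r x)) (vsval z) h).
Qed.

End LocalRepresentation.

(** * Ranks over the localization and over its semisimple model *)

Section SplitRank.
Variables (S : comPzRingType) (E : pzRingType) (iota : {rmorphism S -> E}).

(* With denominators cleared: over the localization [E_p], [1%:M] factors through [N]. *)
Definition split_rank (p : spec S) u r t (N : 'M[E]_(r, t)) : Prop :=
  exists (x : 'M_(u, r)) (y : 'M_(t, u)) (s : S),
    ~ spec_set p s /\ x *m N *m y = (iota s)%:M.

Lemma split_rank_mulr p u r t t' (N : 'M[E]_(r, t)) (Y : 'M_(t, t')) :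
  split_rank p u (N *m Y) -> split_rank p u N.
Proof. by move=> [x [y [s [ps e]]]]; exists x, (Y *m y), s; rewrite !mulmxA -e mulmxA. Qed.

Lemma split_rank_leq p u v r t (N : 'M[E]_(r, t)) :
  (v <= u)%N -> split_rank p u N -> split_rank p v N.
Proof.
move=> vu [x [y [s [ps e]]]].
exists (rowsub (widen_ord vu) x), (colsub (widen_ord vu) y), s; split=> //.
rewrite !mul_rowsub_mx mulmx_colsub e.
by apply/matrixP => i j; rewrite !mxE.
Qed.

Hypothesis iotaC : forall s y, iota s * y = y * iota s.

Lemma scaler_iota_mulmx r t m (M : 'M[E]_(r, t)) (N : 'M_(t, m)) s :
  M *m (iota s *: N) = iota s *: (M *m N).
Proof.
apply/matrixP => i j; rewrite !mxE mulr_sumr; apply: eq_bigr => l _.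
by rewrite mxE mulrA -iotaC mulrA.
Qed.

Lemma iota_scalar_mxC r t (M : 'M[E]_(r, t)) s :
  M *m (iota s)%:M = (iota s)%:M *m M.
Proof. by rewrite -[in LHS]scalemx1 scaler_iota_mulmx mulmx1 mul_scalar_mx. Qed.

Hypothesis E_fg : exists N (e : 'I_N -> E), forall x, exists c : 'I_N -> S,
  x = \sum_i iota (c i) * e i.
Variable p : spec S.
Hypothesis iota_p : forall s, iota s = 0 -> spec_set p s.

Section Model.
Variables (k : fieldType) (kappa : {rmorphism S -> k}).
Hypothesis kappa0 : forall s, kappa s = 0 <-> spec_set p s.
Variables (A : falgType k) (rho : {rmorphism E -> A}).
Hypothesis Asp : semiprime A.
Hypothesis rho_iota : forall s, rho (iota s) = (kappa s)%:A.
Hypothesis rho_surj : forall a, exists s x, ~ spec_set p s /\ kappa s *: a = rho x.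
Hypothesis rho_unit : forall x z, z * rho x = 1 \/ rho x * z = 1 ->
  exists y s, ~ spec_set p s /\ y * x = iota s.

Let k0 s : ~ spec_set p s -> kappa s != 0.
Proof. by move=> ps; apply/eqP => /kappa0. Qed.

Lemma rho_iotaM s x : rho (iota s * x) = kappa s *: rho x.
Proof. by rewrite rmorphM rho_iota -scalerAl mul1r. Qed.

(** Units are detected for elements of [E] only, so a matrix is treated by elimination: its corner
    has a left inverse up to a denominator, and the Schur complement [H2] again has a scalar image
    because the rest of the first column maps to 0. *)
Lemma rho_invertible u (H : 'M[E]_u) s : ~ spec_set p s ->
  map_mx rho H = ((kappa s)%:A)%:M ->
  exists G s', ~ spec_set p s' /\ G *m H = (iota s')%:M.
Proof.
elim: u H s => [|u IH] H s ps HE.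
  by exists 0, 1; split; [exact: prime1|apply/matrixP => -[]].
move: H HE; rewrite -[u.+1]/(1 + u)%N => H HE.
have [y [s1 [ps1 yh]]] : exists y s1, ~ spec_set p s1 /\ y * H (lshift u 0) (lshift u 0) = iota s1.
  apply: (rho_unit (z := (kappa s)^-1%:A)); left.
  have := congr1 (fun M : 'M_(1 + u) => M (lshift u 0) (lshift u 0)) HE.
  rewrite !mxE eqxx mulr1n => ->.
  by rewrite -scalerAl mul1r scalerA mulVf ?k0 // scale1r.
pose c := dlsubmx H; pose r := ursubmx H; pose H' := drsubmx H.
have HB : H = block_mx (H (lshift u 0) (lshift u 0))%:M r c H'.
  rewrite -[LHS]submxK; congr block_mx.
  by apply/rowP => j; rewrite !ord1 !mxE eqxx mulr1n.
have rc : map_mx rho c = 0.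
  by rewrite map_dlsubmx HE scalar_mx_block block_mxKdl.
have rH' : map_mx rho H' = ((kappa s)%:A)%:M.
  by rewrite map_drsubmx HE scalar_mx_block block_mxKdr.
pose H2 := (iota s1)%:M *m H' - c *m y%:M *m r.
have [||G2 [s2 [ps2 G2E]]] := IH H2 (s1 * s); first exact: notin_primeM.
  rewrite map_mxB !map_mxM map_scalar_mx rc !mul0mx subr0 rH' rho_iota -scalar_mxM.
  by rewrite -scalerAl mul1r scalerA rmorphM.
exists (block_mx (iota s2)%:M (- (y%:M *m r *m G2)) 0 ((iota s1)%:M *m G2) *m
  block_mx y%:M 0 (- (c *m y%:M)) (iota s1)%:M), (s1 * s2).
split; first exact: notin_primeM.
rewrite -mulmxA HB !mulmx_block !mul0mx !addr0 -scalar_mxM yh.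
have -> : - (c *m y%:M) *m (H (lshift u 0) (lshift u 0))%:M + (iota s1)%:M *m c = 0.
  by rewrite mulNmx -mulmxA -scalar_mxM yh iota_scalar_mxC addNr.
have -> : - (c *m y%:M) *m r + (iota s1)%:M *m H' = H2 by rewrite mulNmx addrC.
rewrite !mulmx0 !addr0 !add0r mulNmx -[_ *m G2 *m H2]mulmxA G2E (iota_scalar_mxC (y%:M *m r)).
by rewrite addrN -mulmxA G2E -!scalar_mxM -!rmorphM [s2 * _]mulrC -scalar_mx_block.
Qed.

Lemma split_rank_rank_ge u r t (N : 'M[E]_(r, t)) :
  split_rank p u N -> rank_ge u (map_mx rho N).
Proof.
move=> [x [y [s [ps e]]]].
apply: (@rank_ge_factor _ _ _ _ _ _ ((kappa s)^-1%:A *: map_mx rho x) (map_mx rho y)).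
rewrite -!scalemxAl -!map_mxM e map_scalar_mx rho_iota -mul_scalar_mx -scalar_mxM.
by rewrite -scalerAl mul1r scalerA mulVf ?k0 // scale1r.
Qed.

Lemma lift_matrix u r (X : 'M[A]_(u, r)) :
  exists s (x : 'M[E]_(u, r)), ~ spec_set p s /\ map_mx rho x = (kappa s)%:A *: X.
Proof.
have [|[i j]|s ps sP] := @common_denominator S p ('I_u * 'I_r)%type (fun ij s =>
    exists x, kappa s *: X ij.1 ij.2 = rho x).
- by move=> ij s t [x xE]; exists (iota t * x); rewrite rho_iotaM -xE rmorphM scalerA.
- by have [s [x [ps xE]]] := rho_surj (X i j); exists s => //; exists x.
have [f fP] := choice sP.
exists s, (\matrix_(i, j) f (i, j)); split=> //.
by apply/matrixP => i j; rewrite !mxE -(fP (i, j)) /= -scalerAl mul1r.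
Qed.

(** The factors found over [A] lift up to denominators; the lifted product has a scalar image, hence
    a left inverse up to a denominator. *)
Lemma rank_ge_split_rank u r t (N : 'M[E]_(r, t)) :
  rank_ge u (map_mx rho N) -> split_rank p u N.
Proof.
move=> /(rank_ge_exists_factor Asp)[X [Y XNY]].
have [s [x [ps xE]]] := lift_matrix X; have [s' [y [ps' yE]]] := lift_matrix Y.
have [||G [s2 [ps2 GE]]] := @rho_invertible u (x *m N *m y) (s * s').
- exact: notin_primeM.
- rewrite !map_mxM xE yE.
  have -> : (kappa s')%:A *: Y = Y *m ((kappa s')%:A)%:M.
    rewrite -mul_scalar_mx; apply/matrixP => i j; rewrite mul_scalar_mx !mxE.
    rewrite (bigD1 j) //= mxE eqxx mulr1n big1 ?addr0 => [|l lj].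
      by rewrite -scalerAl -scalerAr mul1r mulr1.
    by rewrite mxE (negPf lj) mulr0n mulr0.
  rewrite -!scalemxAl mulmxA XNY mul1mx -mul_scalar_mx -scalar_mxM.
  by rewrite -scalerAl mul1r scalerA rmorphM.
by exists (G *m x), y, s2; rewrite -GE !mulmxA.
Qed.

Lemma split_rank_drop_col_model u r t (phi : 'cV[E]_r) (N : 'M[E]_(r, t)) (C : 'rV_t) :
  split_rank p u.+1 (row_mx phi N) -> split_rank p u (N + phi *m C).
Proof.
move=> /split_rank_rank_ge; rewrite map_row_mx => /rank_ge_drop_col h.
by apply: rank_ge_split_rank; rewrite map_mxD map_mxM; exact: h.
Qed.

(** Taking for [Lam] the image of [iota s * E] makes the correction divisible by [s], hence
    invisible at every prime containing [s]. *)
Lemma split_rank_improve_model r t (phi : 'cV[E]_r) (N : 'M[E]_(r, t)) (D P : 'M_t)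
    (Q : 'M_(t, r)) s : P *m D + Q *m N = 1%:M -> ~ spec_set p s ->
  exists C : 'rV_t, forall u, (u <= t)%N ->
    split_rank p u (row_mx phi N) -> split_rank p u (N + phi *m (iota s *: C) *m D).
Proof.
move=> PDQN ps.
have [||||C [CL CP]] := @rank_ge_improve k A Asp r t (map_mx rho phi) (map_mx rho N)
  (map_mx rho D) (map_mx rho P) (map_mx rho Q) (fun a => exists x, a = rho (iota s * x)).
- by exists 0; rewrite mulr0 rmorph0.
- by move=> _ _ [x ->] [y ->]; exists (x + y); rewrite -rmorphD -mulrDr.
- move=> a; have [s' [x [ps' xE]]] := rho_surj a.
  exists (kappa s * kappa s'); first by rewrite mulf_neq0 ?k0.
  by exists x; rewrite -scalerA xE rho_iotaM.
- by rewrite -!map_mxM -map_mxD PDQN map_scalar_mx rmorph1.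
have [f fP] := choice CL; exists (\row_i f i) => u ut.
move=> /split_rank_rank_ge; rewrite map_row_mx => /(CP u ut) h.
apply: rank_ge_split_rank; rewrite map_mxD !map_mxM.
have -> // : map_mx rho (iota s *: (\row_i f i)) = C.
by apply/rowP => i; rewrite fP !mxE.
Qed.

Lemma split_rank_congr_model u r t (N X : 'M[E]_(r, t)) z : spec_set p z ->
  split_rank p u N -> split_rank p u (N + iota z *: X).
Proof.
move=> /kappa0 pz /split_rank_rank_ge h; apply: rank_ge_split_rank.
have -> // : map_mx rho (N + iota z *: X) = map_mx rho N.
by apply/matrixP => i j; rewrite !mxE rmorphD rho_iotaM pz scale0r addr0.
Qed.

(** For one column, [x *m N] is a single element with a right inverse in [A]; detection of units
    turns it into a left inverse up to a denominator. *)
Lemma split_rank1_model r (N : 'cV[E]_r) : split_rank p 1 N ->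
  exists (z : 'rV_r) s, ~ spec_set p s /\ z *m N = (iota s)%:M.
Proof.
move=> [x [y [s [ps e]]]].
have [|w [s' [ps' wE]]] := @rho_unit ((x *m N) 0 0) (rho (y 0 0) * (kappa s)^-1%:A).
  right; rewrite mulrA -rmorphM.
  have -> : (x *m N) 0 0 * y 0 0 = iota s.
    by have := congr1 (fun M : 'M_1 => M 0 0) e; rewrite [LHS]mxE big_ord1 [RHS]mxE.
  by rewrite rho_iota -scalerAl mul1r scalerA divff ?k0 // scale1r.
exists (w *: x), s'; split=> //.
by apply/matrixP => i j; rewrite !ord1 -scalemxAl [LHS]mxE wE mxE.
Qed.

End Model.

Lemma split_rank_lemmas :
  [/\ (forall u r t (phi : 'cV[E]_r) (N : 'M[E]_(r, t)) (C : 'rV_t),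
        split_rank p u.+1 (row_mx phi N) -> split_rank p u (N + phi *m C)),
      (forall r t (phi : 'cV[E]_r) (N : 'M[E]_(r, t)) (D P : 'M_t) (Q : 'M_(t, r)) s,
        P *m D + Q *m N = 1%:M -> ~ spec_set p s ->
        exists C : 'rV_t, forall u, (u <= t)%N -> split_rank p u (row_mx phi N) ->
          split_rank p u (N + phi *m (iota s *: C) *m D)),
      (forall u r t (N X : 'M[E]_(r, t)) z, spec_set p z ->
        split_rank p u N -> split_rank p u (N + iota z *: X)) &
      (forall r (N : 'cV[E]_r), split_rank p 1 N ->
        exists (z : 'rV_r) s, ~ spec_set p s /\ z *m N = (iota s)%:M)].
Proof.
have [k [kappa [kappa0 kappa_frac]]] := residue_field p.
have [A [rho [Asp ri rs ru]]] := local_algebra iotaC E_fg iota_p kappa0 kappa_frac.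
split.
- move=> u r t phi N C; exact: (split_rank_drop_col_model kappa0 Asp ri rs ru).
- move=> r t phi N D P Q s; exact: (split_rank_improve_model kappa0 Asp ri rs ru).
- move=> u r t N X z; exact: (split_rank_congr_model kappa0 Asp ri rs ru).
- move=> r N; exact: (split_rank1_model kappa0 ri ru).
Qed.

End SplitRank.

(** * Noetherian rings and their primes *)

Section Noetherian.
Variable S : comPzRingType.
Hypothesis S_noeth : noetherian S.
Implicit Types (I J : set S) (p q : spec S).

(** Otherwise ideals violating [P] form a strictly increasing sequence; its union is finitely
    generated, and one member already contains the generators. *)
Lemma noetherian_ind (P : set S -> Prop) :
  (forall I, ideal I -> (forall J, ideal J -> I `<=` J -> J <> I -> P J) -> P I) ->
  forall I, ideal I -> P I.
Proof.
move=> step I0 iI0; apply: contrapT => nP0.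
pose T := {I : set S | ideal I /\ ~ P I}.
have next (x : T) : exists y : T, sval x `<=` sval y /\ sval y <> sval x.
  case: x => I [iI nP] /=; apply: contrapT => nex; apply: nP; apply: step => // J iJ IJ JI.
  apply: contrapT => nPJ; apply: nex.
  by exists (exist _ J (conj iJ nPJ)).
have [f fP] := choice next.
pose x0 : T := exist _ I0 (conj iI0 nP0).
pose c n := sval (iter n f x0).
have cS n : c n `<=` c n.+1 by rewrite /c iterS; case: (fP (iter n f x0)).
have cle m n : (m <= n)%N -> c m `<=` c n.
  by move=> /subnK <-; elim: (n - m)%N => // d IH x /IH /cS.
have ci n : ideal (c n) by rewrite /c; case: (iter n f x0) => I [].
pose U : set S := [set x | exists n, c n x].
have iU : ideal U.
  split; first by exists 0%N; case: (ci 0%N).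
  - move=> x y [m xm] [n yn]; exists (maxn m n); case: (ci (maxn m n)) => _ + _; apply.
      exact: cle (leq_maxl _ _) _ xm.
    exact: cle (leq_maxr _ _) _ yn.
  - by move=> a x [m xm]; exists m; case: (ci m) => _ _; apply.
have [N [g gE]] := S_noeth iU.
have gU i : U (g i).
  rewrite gE; exists (fun j => (j == i)%:R); rewrite (bigD1 i) //= eqxx mul1r big1 ?addr0 //.
  by move=> j /negPf ->; rewrite mul0r.
have [h hP] := choice gU.
pose M := (\max_i h i)%N.
have : c M.+1 <> c M by rewrite /c iterS; case: (fP (iter M f x0)).
apply.
apply/seteqP; split; last exact: cS.
move=> x xM; have : U x by exists M.+1.
rewrite gE => -[a ->]; apply: (big_ind (c M)); first by case: (ci M).
- by move=> u v; case: (ci M) => _ + _; apply.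
- move=> i _; case: (ci M) => _ _; apply.
  by apply: (cle (h i)) (hP i); exact: leq_bigmax.
Qed.

Lemma ideal_add I x : ideal I -> ideal [set z | exists i a, I i /\ z = i + a * x].
Proof.
move=> [I0 ID IM]; split.
- by exists 0, 0; rewrite mul0r addr0.
- move=> _ _ [i [a [Ii ->]]] [j [b [Ij ->]]]; exists (i + j), (a + b).
  by split; [exact: ID|rewrite mulrDl addrACA].
- move=> c _ [i [a [Ii ->]]]; exists (c * i), (c * a).
  by split; [exact: IM|rewrite mulrDr mulrA].
Qed.

Lemma exists_maximal_ideal I : ideal I -> ~ I 1 -> exists m, maximal_ideal m /\ I `<=` m.
Proof.
move: I; apply: noetherian_ind => I iI IH I1.
have [[J [iJ IJ JI J1]]|nJ] := pselect (exists J, [/\ ideal J, I `<=` J, J <> I & ~ J 1]).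
  by have [m [mm Jm]] := IH J iJ IJ JI J1; exists m; split=> // x /IJ /Jm.
exists I; split=> //; split=> // J iJ J1 IJ; apply: contrapT => JI.
by apply: nJ; exists J.
Qed.

Lemma maximal_prime_ideal I : maximal_ideal I -> prime_ideal I.
Proof.
move=> [iI I1 Imax]; split=> // x y xy; have [Ix|Ix] := pselect (I x); [by left|right].
pose J : set S := [set z | exists i a, I i /\ z = i + a * x].
have iJ : ideal J by exact: ideal_add.
have [i [a [Ii e]]] : J 1.
  apply: contrapT => J1; apply: Ix; rewrite -(Imax J iJ J1).
    by exists 0, 1; case: iI => ? _ _; rewrite mul1r add0r.
  by move=> z Iz; exists z, 0; rewrite mul0r addr0.
case: iI => _ ID IM; rewrite -[y]mul1r e mulrDl; apply: ID; last by rewrite -mulrA; exact: IM.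
by rewrite mulrC; exact: IM.
Qed.

Lemma spec_inj p q : spec_set p = spec_set q -> p = q.
Proof.
by case: p q => [p pp] [q qp] /= e; subst q; congr Spec; exact: Prop_irrelevance.
Qed.

Variable X : set (spec S).
(* Plays the role of the sobriety of [X]. *)
Hypothesis X_bigcap : forall (D : set (spec S)) q, D `<=` X ->
  spec_set q = \bigcap_(p in D) spec_set p -> X q.

(** Noetherian induction on an ideal [I] that the points must contain. Their intersection [I']
    contains 1 if there are no points. If it is prime, it is in [X] and is the least point.
    Otherwise it contains some [x * y] but neither factor, and the points containing [x] and those
    containing [y] are treated separately. [Z] is any set, as the sets describing loci of small rank
    are not evidently closed under addition. *)
Lemma finite_minimal_primes (Z : set S) : exists Q : seq (spec S),
  (forall q, q \in Q -> X q /\ Z `<=` spec_set q) /\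
  forall p, X p -> Z `<=` spec_set p -> exists2 q, q \in Q & spec_set q `<=` spec_set p.
Proof.
suff H I : ideal I -> exists Q : seq (spec S),
    (forall q, q \in Q -> X q /\ Z `<=` spec_set q) /\
    forall p, X p -> Z `<=` spec_set p -> I `<=` spec_set p ->
      exists2 q, q \in Q & spec_set q `<=` spec_set p.
  have [|Q [Q1 Q2]] := H [set 0].
    by split=> // [x y /= -> ->|a x /= ->]; rewrite ?addr0 ?mulr0.
  by exists Q; split=> // p Xp Zp; apply: Q2 => // _ ->; exact: prime0.
move: I; apply: noetherian_ind => I iI IH.
pose D : set (spec S) := [set p | [/\ X p, Z `<=` spec_set p & I `<=` spec_set p]].
pose I' : set S := \bigcap_(p in D) spec_set p.
have iI' : ideal I'.
  split=> [p _|x y xI yI p Dp|a x xI p Dp]; first exact: prime0.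
    by apply: primeD; [exact: xI|exact: yI].
  by apply: primeMl; exact: xI.
have [I1|I1] := pselect (I' 1).
  by exists [::]; split=> // p Xp Zp Ip; case: (@prime1 S p); exact: I1.
have [Ip|Inp] := pselect (forall x y, I' (x * y) -> I' x \/ I' y).
  have pI' : prime_ideal I' by split.
  exists [:: Spec pI']; split=> [q|p Xp Zp Ip']; last first.
    by exists (Spec pI'); rewrite ?mem_seq1 //= => x; apply.
  rewrite mem_seq1 => /eqP -> /=; split.
    by apply: (X_bigcap (D := D)) => // p [].
  by move=> z Zz p [_ Zp _]; exact: Zp.
have [x [y [xy [Ix Iy]]]] : exists x y, I' (x * y) /\ ~ I' x /\ ~ I' y.
  apply: contrapT => N; apply: Inp => x y xy; apply: contrapT => /not_orP[Ix Iy].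
  by apply: N; exists x, y.
have II' : I `<=` I' by move=> z Iz p [_ _]; apply.
have IHx z : ~ I' z -> exists Q : seq (spec S),
    (forall q, q \in Q -> X q /\ Z `<=` spec_set q) /\
    forall p, X p -> Z `<=` spec_set p -> I `<=` spec_set p -> spec_set p z ->
      exists2 q, q \in Q & spec_set q `<=` spec_set p.
  move=> Iz; have [||Q [Q1 Q2]] := IH _ (ideal_add z iI).
  - by move=> i Ii; exists i, 0; rewrite mul0r addr0.
  - move=> e; apply/Iz/II'; rewrite -e; exists 0, 1; rewrite mul1r add0r.
    by split=> //; case: iI.
  exists Q; split=> // p Xp Zp Ip pz; apply: Q2 => // _ [i [a [Ii ->]]].
  by apply: primeD; [exact: Ip|exact: primeMl].
have [Q [Q1 Q2]] := IHx x Ix; have [Q' [Q1' Q2']] := IHx y Iy.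
exists (Q ++ Q'); split=> [q|p Xp Zp Ip].
  by rewrite mem_cat => /orP[/Q1|/Q1'].
have : spec_set p (x * y) by apply: xy.
case: (spec_prime p) => _ _ /[apply] -[px|py].
  by have [q qQ qp] := Q2 p Xp Zp Ip px; exists q => //; rewrite mem_cat qQ.
by have [q qQ qp] := Q2' p Xp Zp Ip py; exists q => //; rewrite mem_cat qQ orbT.
Qed.

Lemma exists_minimal_prime (Q : seq (spec S)) : Q <> [::] ->
  exists2 p, p \in Q & forall q, q \in Q -> spec_set q `<=` spec_set p -> q = p.
Proof.
elim: Q => // x Q IH _; have [->|/eqP/IH[m mQ mmin]] := eqVneq Q [::].
  by exists x; rewrite ?mem_seq1 // => q; rewrite mem_seq1 => /eqP.
have [xm|xm] := pselect (spec_set x `<=` spec_set m).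
  exists x; first by rewrite mem_head.
  move=> q; rewrite in_cons => /orP[/eqP //|qQ qx].
  have qm : q = m by apply: mmin => // z /qx /xm.
  by apply/spec_inj/seteqP; split; rewrite // qm.
exists m; first by rewrite in_cons mQ orbT.
by move=> q; rewrite in_cons => /orP[/eqP ->|/mmin //].
Qed.

Lemma prime_avoidance p (Q : seq (spec S)) :
  (forall q, q \in Q -> ~ spec_set q `<=` spec_set p) ->
  exists s, ~ spec_set p s /\ forall q, q \in Q -> spec_set q s.
Proof.
elim: Q => [|q Q IH] Qp; first by exists 1; split=> //; exact: prime1.
have [|s [ps sQ]] := IH; first by move=> q' q'Q; apply: Qp; rewrite in_cons q'Q orbT.
have /existsNP[z /not_implyP[qz pz]] : ~ spec_set q `<=` spec_set p.
  by apply: Qp; exact: mem_head.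
exists (s * z); split; first exact: notin_primeM.
move=> q'; rewrite in_cons => /orP[/eqP ->|/sQ q's]; first exact: primeMl.
by rewrite mulrC; exact: primeMl.
Qed.

End Noetherian.

(** * The stable range theorem *)

(* For [p] in [X], this gives [n <= dim_X(p)]. *)
Fixpoint prime_chain (S : comPzRingType) (X : set (spec S)) (n : nat) (p : spec S) : Prop :=
  if n is n'.+1 then
    exists q, [/\ X q, spec_set p `<=` spec_set q, q <> p & prime_chain X n' q]
  else True.

Section StableRange.
Variables (S : comPzRingType) (E : pzRingType) (iota : {rmorphism S -> E}).
Hypothesis S_noeth : noetherian S.
Hypothesis iotaC : forall s y, iota s * y = y * iota s.
Hypothesis E_fg : exists N (e : 'I_N -> E), forall x, exists c : 'I_N -> S,
  x = \sum_i iota (c i) * e i.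
Variable X : set (spec S).
Hypothesis X_bigcap : forall (D : set (spec S)) q, D `<=` X ->
  spec_set q = \bigcap_(p in D) spec_set p -> X q.
Hypothesis X_supp : forall p, X p -> forall s, iota s = 0 -> spec_set p s.
Hypothesis X_maximal : forall p, maximal_ideal (spec_set p) ->
  (forall s, iota s = 0 -> spec_set p s) -> X p.

Local Notation split_rank := (split_rank iota).

(** A minimal prime [p] of [F] is treated last: some [s] outside [p] lies in all other primes of
    [F], so a correction divisible by [s] secures the rank at [p] without affecting the others. *)
Lemma split_rank_improve_finite r t (phi : 'cV[E]_r) (N : 'M[E]_(r, t)) (D P : 'M_t)
    (Q : 'M_(t, r)) (F : seq (spec S)) :
  P *m D + Q *m N = 1%:M -> (forall p, p \in F -> X p) ->
  exists C : 'rV_t, forall p, p \in F -> forall u, (u <= t)%N ->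
    split_rank p u (row_mx phi N) -> split_rank p u (N + phi *m C *m D).
Proof.
move=> PDQN; have [n] := ubnP (size F); elim: n F => // n IH F sF FX.
have [->|/eqP F0] := eqVneq F [::]; first by exists 0.
have [p pF pmin] := exists_minimal_prime F0.
pose F' := seq.filter (predC1 p) F.
have sF' : (size F' < size F)%N.
  by rewrite size_filter -(count_predC (predC1 p)) -[ltnLHS]addn0 ltn_add2l
    -has_count; apply/hasP; exists p => //=; rewrite negbK.
have [||C1 C1P] := IH F'; first exact: leq_trans sF' _.
  by move=> q; rewrite mem_filter => /andP[_ /FX].
have [|s [ps sF2]] := @prime_avoidance S p F'.
  by move=> q; rewrite mem_filter /= => /andP[/eqP qp qF] /(pmin _ qF).
pose N1 := N + phi *m C1 *m D.
have PDQN1 : (P - Q *m phi *m C1) *m D + Q *m N1 = 1%:M.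
  by rewrite -PDQN mulmxBl mulmxDr !mulmxA addrACA addNr addr0.
have [_ improve _ _] := split_rank_lemmas iotaC E_fg (X_supp (FX _ pF)).
have [C2 C2P] := improve _ _ phi N1 D _ Q s PDQN1 ps.
have NE : N + phi *m (C1 + iota s *: C2) *m D = N1 + phi *m (iota s *: C2) *m D.
  by rewrite mulmxDr mulmxDl addrA.
exists (C1 + iota s *: C2) => q qF u ut; rewrite NE.
have [->|qp] := eqVneq q p.
  move=> h; apply: C2P => //; move: h.
  (* The first correction is an invertible column operation once [phi] is present, so the rank of
     the full matrix at [p] is unchanged. *)
  have -> : row_mx phi N = row_mx phi N1 *m block_mx 1%:M (- (C1 *m D)) 0 1%:M.
    rewrite mul_row_block !mulmx1 mulmx0 addr0 mulmxN /N1 mulmxA.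
    by rewrite addrC addrK.
  exact: split_rank_mulr.
have qF' : q \in F' by rewrite mem_filter /= qp.
move=> /(C1P q qF' u ut) h.
have [_ _ congr _] := split_rank_lemmas iotaC E_fg (X_supp (FX _ qF)).
rewrite scaler_iota_mulmx // -scalemxAl; apply: congr => //.
exact: sF2.
Qed.

Definition chain_split t r (N : 'M[E]_(r, t)) : Prop :=
  forall p, X p -> forall n, prime_chain X n p -> split_rank p (minn t n.+1) N.

(* Outside of the finitely many minimal primes of the loci where the split rank is at
   most [v], losing one unit of rank is harmless: a point of such a locus strictly
   contains another one, along which the chain is longer. *)
Lemma chain_split_drop_col r t (phi : 'cV[E]_r) (N : 'M[E]_(r, t)) (D P : 'M_t)
    (Q : 'M_(t, r)) :
  P *m D + Q *m N = 1%:M -> chain_split (row_mx phi N) ->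
  exists C : 'rV_t, chain_split (N + phi *m C *m D).
Proof.
move=> PDQN csN; pose Phi := row_mx phi N.
pose Z v : set S := [set s | exists (x : 'M_(v, r)) y, x *m Phi *m y = (iota s)%:M].
have ZP p v : ~ split_rank p v Phi -> Z v `<=` spec_set p.
  move=> nsp s [x [y xy]]; apply: contrapT => ps; apply: nsp.
  by exists x, y, s.
have ZN p v : Z v `<=` spec_set p -> ~ split_rank p v Phi.
  by move=> Zp [x [y [s [ps e]]]]; apply/ps/Zp; exists x, y.
have [G GP] := choice (fun v => finite_minimal_primes S_noeth X_bigcap (Z v.+1)).
have [|C CP] := @split_rank_improve_finite r t phi N D P Q
    (flatten [seq G v | v <- seq.iota 0 t.+1]) PDQN.
  by move=> p /flattenP[_ /mapP[v _ ->] pG]; case: (GP v) => + _ => /(_ p pG)[].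
exists C => p Xp n pn; set v := minn t n.+1.
have vt : (v <= t)%N by exact: geq_minl.
have [drop _ _ _] := split_rank_lemmas iotaC E_fg (X_supp Xp).
have [sp|nsp] := pselect (split_rank p v.+1 Phi).
  by rewrite -mulmxA; exact: drop.
have [q qG qp] := (GP v).2 p Xp (ZP _ _ nsp).
have [Xq Zq] := (GP v).1 q qG.
have [qpE|qpN] := eqVneq q p.
  apply: CP => //.
    apply/flattenP; exists (G v); last by rewrite -qpE.
    by apply/mapP; exists v => //; rewrite mem_iota.
  by apply: split_rank_leq (csN p Xp n pn); rewrite /v; lia.
case: (ZN _ _ Zq); apply: split_rank_leq (csN q Xq n.+1 _); first by rewrite /v; lia.
by exists p; split=> //; apply/eqP; rewrite eq_sym.
Qed.

(** The [s] with [z *m N = iota s] for some [z] form an ideal. A maximal ideal above it would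
    contain the kernel of [iota], hence lie in [X], and the splitting there yields such an [s]
    outside it. *)
Lemma split_rank1_globally r (N : 'cV[E]_r) :
  (forall p, X p -> split_rank p 1 N) -> exists z : 'rV_r, z *m N = 1%:M.
Proof.
move=> N1; pose J : set S := [set s | exists z : 'rV_r, z *m N = (iota s)%:M].
have iJ : ideal J.
  split; first by exists 0; rewrite mul0mx rmorph0 raddf0.
    by move=> s t [z zE] [w wE]; exists (z + w); rewrite mulmxDl zE wE -raddfD -rmorphD.
  move=> a s [z zE]; exists (iota a *: z).
  by rewrite -scalemxAl zE rmorphM scalar_mxM mul_scalar_mx.
have [[z zE]|J1] := pselect (J 1); first by exists z; rewrite zE rmorph1.
have [m [mm Jm]] := exists_maximal_ideal S_noeth iJ J1.
pose p := Spec (maximal_prime_ideal mm).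
have Xp : X p.
  by apply: X_maximal => // s s0; apply: Jm; exists 0; rewrite mul0mx s0 raddf0.
have [_ _ _ one] := split_rank_lemmas iotaC E_fg (X_supp Xp).
have [z [s [ps zs]]] := one _ _ (N1 p Xp).
by case: ps; apply: Jm; exists z.
Qed.

(** Each round merges the first column [psi] of [Psi] into the others. [N] may change only by
    [psi c1 a], the other columns freely. The relation [b a + g N = 1] persists with [b - g psi c1]
    in place of [b]. *)
Theorem stable_range r t (N : 'cV[E]_r) (Psi : 'M[E]_(r, t)) (a b : 'M[E]_1) (g : 'rV[E]_r) :
  b *m a + g *m N = 1%:M -> chain_split (row_mx N Psi) ->
  exists (c : 'cV_t) (z : 'rV_r), z *m (N + Psi *m c *m a) = 1%:M.
Proof.
elim: t Psi N b => [|t IH] Psi N b.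
  move=> _ cs; have [|z zN] := @split_rank1_globally r N.
    move=> p Xp; have := cs p Xp 0%N I.
    have -> : row_mx N Psi = N *m row_mx 1%:M 0.
      by rewrite mul_mx_row mulmx1 mulmx0; congr row_mx; exact: thinmx0.
    by move=> /split_rank_mulr.
  by exists 0, z; rewrite mulmx0 mul0mx addr0.
move: Psi; rewrite -[t.+1]/(1 + t)%N => Psi baN cs.
pose psi := lsubmx Psi; pose Psi' := rsubmx Psi.
have [||C csC] := @chain_split_drop_col r (1 + t) psi (row_mx N Psi')
  (block_mx a 0 0 1%:M) (block_mx b (- (g *m Psi')) 0 1%:M) (col_mx g 0).
- rewrite mulmx_block mul_col_row !mulmx0 !mul0mx !mulmx1 !addr0 !add0r.
  by rewrite add_block_mx baN addNr !addr0 -scalar_mx_block.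
- move=> p Xp n pn; have := cs p Xp n pn.
  (* [Y] exchanges [N] and [psi]: the column to be removed has to come first. *)
  pose Y : 'M[E]_(1 + (1 + t)) := row_mx (col_mx 0 (col_mx 1%:M 0))
    (row_mx (col_mx 1%:M 0) (col_mx 0 (col_mx 0 1%:M))).
  have -> : row_mx N Psi = row_mx psi (row_mx N Psi') *m Y.
    rewrite !mul_mx_row !mul_row_col !mulmx0 !mulmx1 !addr0 !add0r.
    by rewrite hsubmxK.
  by move=> /split_rank_mulr.
pose c1 := lsubmx C; pose C2 := rsubmx C.
have [||c [z zE]] := IH (Psi' + psi *m C2) (N + psi *m c1 *m a) (b - g *m psi *m c1).
- by rewrite -baN mulmxBl mulmxDr !mulmxA addrACA addNr addr0.
- have <- // : row_mx N Psi' + psi *m C *m block_mx a 0 0 1%:M =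
    row_mx (N + psi *m c1 *m a) (Psi' + psi *m C2).
  rewrite -{1}(hsubmxK C) -mulmxA mul_row_block !mulmx0 mulmx1 addr0 add0r.
  by rewrite mul_mx_row add_row_mx mulmxA.
exists (col_mx (c1 + C2 *m c) c), z; rewrite -zE; congr (_ *m _).
rewrite -{1}(hsubmxK Psi) mul_row_col -/psi -/Psi' mulmxDr !mulmxDl !mulmxA -!addrA.
by congr (_ + (_ + _)); rewrite addrC.
Qed.

End StableRange.

(** * Modules over a Noetherian ring *)

Lemma linear_of_fun (R : pzRingType) (U V : lmodType R) (f : U -> V) : linear f ->
  exists g : {linear U -> V}, g =1 f.
Proof.
move=> fl; pose g : {linear U -> V} := HB.pack f (GRing.isLinear.Build R U V _ f fl).
by exists g.
Qed.

Lemma comp_is_linear (R : pzRingType) (U V W : lmodType R) (f : V -> W) (g : U -> V) :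
  linear f -> linear g -> linear (fun x => f (g x)).
Proof. by move=> fl gl c x y; rewrite gl fl. Qed.

Lemma add_is_linear (R : pzRingType) (U V : lmodType R) (f g : U -> V) :
  linear f -> linear g -> linear (fun x => f x + g x).
Proof. by move=> fl gl c x y; rewrite fl gl scalerDr addrACA. Qed.

Lemma sub_is_linear (R : pzRingType) (U V : lmodType R) (f g : U -> V) :
  linear f -> linear g -> linear (fun x => f x - g x).
Proof. by move=> fl gl c x y; rewrite fl gl scalerBr opprD addrACA. Qed.

Lemma scale_is_linear (R : comPzRingType) (U V : lmodType R) (f : U -> V) s :
  linear f -> linear (fun x => s *: f x).
Proof. by move=> fl c x y; rewrite fl scalerDr !scalerA mulrC. Qed.

Lemma sum_is_linear (R : pzRingType) (U V : lmodType R) (I : finType) (f : I -> U -> V) :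
  (forall i, linear (f i)) -> linear (fun x => \sum_i f i x).
Proof.
move=> fl c x y; rewrite scaler_sumr -big_split; apply: eq_bigr => i _.
by rewrite fl.
Qed.

Section LinearFacts.
Variables (R : pzRingType) (U V : lmodType R) (f : U -> V) (fl : linear f).

Lemma linear_fun0 : f 0 = 0.
Proof. by have [g gE] := linear_of_fun fl; rewrite -gE linear0. Qed.

Lemma linear_funD x y : f (x + y) = f x + f y.
Proof. by rewrite -{1}[x]scale1r fl scale1r. Qed.

Lemma linear_funZ c x : f (c *: x) = c *: f x.
Proof. by rewrite -[_ *: x]addr0 fl linear_fun0 addr0. Qed.

Lemma linear_funB x y : f (x - y) = f x - f y.
Proof. by rewrite linear_funD -scaleN1r linear_funZ scaleN1r. Qed.

Lemma linear_fun_sum (I : finType) (F : I -> U) : f (\sum_i F i) = \sum_i f (F i).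
Proof. by apply: (big_morph f linear_funD linear_fun0). Qed.

Lemma linear_inverse g : cancel f g -> cancel g f -> linear g.
Proof. by move=> fg gf c x y; apply: (canLR fg); rewrite fl !gf. Qed.

End LinearFacts.

Section FinitelyGenerated.
Variable S : comPzRingType.
Hypothesis S_noeth : noetherian S.

Definition submodule (V : lmodType S) (P : V -> Prop) : Prop :=
  P 0 /\ forall c x y, P x -> P y -> P (c *: x + y).

(** Induction on [n]. The coefficients of [g ord0] in elements of [P] form an ideal; subtracting
    combinations of lifts [v j] of its generators leaves elements of [P] in the span of the other
    [g i]. *)
Lemma submodule_fg_in_span (V : lmodType S) n (g : 'I_n -> V) (P : V -> Prop) :
  submodule P -> (forall x, P x -> exists c : 'I_n -> S, x = \sum_i c i *: g i) ->
  exists N (h : 'I_N -> V), (forall i, P (h i)) /\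
    forall x, P x -> exists c : 'I_N -> S, x = \sum_i c i *: h i.
Proof.
elim: n g P => [|n IH] g P [P0 PL] Pg.
  exists 0%N, (fun=> 0); split=> // x /Pg[c ->].
  by exists (fun=> 0); rewrite !big_ord0.
have PZ c x : P x -> P (c *: x) by move=> Px; rewrite -[_ *: x]addr0; exact: PL.
have PD x y : P x -> P y -> P (x + y) by move=> Px Py; rewrite -[x]scale1r; exact: PL.
have Psum m (F : 'I_m -> V) : (forall i, P (F i)) -> P (\sum_i F i).
  by move=> PF; apply: (big_ind P).
pose I : set S := [set a | exists2 x, P x & exists c : 'I_n -> S,
  x = a *: g ord0 + \sum_i c i *: g (lift ord0 i)].
have iI : ideal I.
  split.
  - by exists 0 => //; exists (fun=> 0); rewrite scale0r big1 ?addr0 // => i _; rewrite scale0r.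
  - move=> a b [x Px [c xE]] [y Py [d yE]]; exists (x + y); first exact: PD.
    exists (fun i => c i + d i); rewrite xE yE scalerDl addrACA; congr (_ + _).
    by rewrite -big_split; apply: eq_bigr => i _; rewrite scalerDl.
  - move=> b a [x Px [c xE]]; exists (b *: x); first exact: PZ.
    exists (fun i => b * c i); rewrite xE scalerDr scalerA scaler_sumr; congr (_ + _).
    by apply: eq_bigr => i _; rewrite scalerA.
have [m [a aE]] := S_noeth iI.
have /choice[v vP] : forall j, exists x, P x /\ exists c : 'I_n -> S,
    x = a j *: g ord0 + \sum_i c i *: g (lift ord0 i).
  move=> j; have [x Px xE] : I (a j).
    rewrite aE; exists (fun i => (i == j)%:R); rewrite (bigD1 j) //= eqxx mul1r big1 ?addr0 //.
    by move=> i /negPf ->; rewrite mul0r.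
  by exists x.
pose P' x := P x /\ exists c : 'I_n -> S, x = \sum_i c i *: g (lift ord0 i).
have [||N [h [hP' hgen]]] := IH (fun i => g (lift ord0 i)) P'; last 1 first.
- exists (m + N)%N, (fun i => match split i with inl j => v j | inr j => h j end).
  split=> [i|x Px]; first by case: (split i) => j; [case: (vP j)|case: (hP' j)].
  have [c cE] := Pg x Px; rewrite big_ord_recl in cE.
  have : I (c ord0) by exists x => //; exists (fun i => c (lift ord0 i)).
  rewrite aE => -[b bE].
  have : P' (x - \sum_j b j *: v j).
    split; first by rewrite -scaleN1r addrC; apply: PL => //; apply: Psum => j; apply: PZ; case: (vP j).
    have /choice[d dE] := fun j => (vP j).2.
    exists (fun i => c (lift ord0 i) - \sum_j b j * d j i).
    have -> : \sum_j b j *: v j = c ord0 *: g ord0 + \sum_i (\sum_j b j * d j i) *: g (lift ord0 i).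
      under eq_bigr => j _ do rewrite dE scalerDr scalerA.
      rewrite big_split /= -scaler_suml -bE; congr (_ + _).
      under eq_bigr => j _ do rewrite scaler_sumr.
      rewrite exchange_big /=; apply: eq_bigr => i _; rewrite scaler_suml.
      by apply: eq_bigr => j _; rewrite scalerA.
    rewrite cE opprD addrACA subrr add0r -sumrB; apply: eq_bigr => i _.
    by rewrite scalerBl.
  move=> /hgen[d dE]; exists (fun i => match split i with inl j => b j | inr j => d j end).
  rewrite big_split_ord -[LHS](subrK (\sum_j b j *: v j)) dE addrC; congr (_ + _).
    apply: eq_bigr => j _; rewrite (_ : split (lshift N j) = inl j) //.
    exact: (unsplitK (inl j)).
  apply: eq_bigr => j _; rewrite (_ : split (rshift m j) = inr j) //.
  exact: (unsplitK (inr j)).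
- split; first by split=> //; exists (fun=> 0); rewrite big1 // => i _; rewrite scale0r.
  move=> b x y [Px [c xE]] [Py [d yE]]; split; first exact: PL.
  exists (fun i => b * c i + d i); rewrite xE yE scaler_sumr -big_split; apply: eq_bigr => i _.
  by rewrite scalerDl scalerA.
- by move=> x [].
Qed.

Lemma submodule_fg (V : lmodType S) (P : V -> Prop) : finitely_generated V -> submodule P ->
  exists N (h : 'I_N -> V), (forall i, P (h i)) /\
    forall x, P x -> exists c : 'I_N -> S, x = \sum_i c i *: h i.
Proof. by move=> [n [g gP]] sP; apply: (submodule_fg_in_span (g := g)). Qed.

Lemma ffun_fg (V : lmodType S) n : finitely_generated V ->
  finitely_generated {ffun 'I_n -> V}.
Proof.
move=> [m [g gP]].
pose G (ij : 'I_n * 'I_m) : {ffun 'I_n -> V} := [ffun l => if l == ij.1 then g ij.2 else 0].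
exists #|{: 'I_n * 'I_m}|, (fun i => G (enum_val i)) => x.
have /choice[c cE] := fun l => gP (x l).
exists (fun i => c (enum_val i).1 (enum_val i).2).
transitivity (\sum_ij c ij.1 ij.2 *: G ij); last first.
  by rewrite (reindex (@enum_val {: 'I_n * 'I_m} predT)) //=; exact/onW_bij/enum_val_bij.
rewrite -(pair_bigA _ (fun i j => c i j *: G (i, j))) /=.
apply/ffunP => l; rewrite sum_ffunE (bigD1 l) //= sum_ffunE [X in _ + X]big1 ?addr0.
  by rewrite cE; apply: eq_bigr => j _; rewrite !ffunE eqxx.
move=> i il; rewrite sum_ffunE big1 // => j _; rewrite !ffunE eq_sym (negPf il).
by rewrite scaler0.
Qed.

(** The values on generators of [K] embed the linear maps into [M^n] as a submodule. *)
Lemma hom_fg (K M : lmodType S) : finitely_generated K -> finitely_generated M ->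
  exists N (h : 'I_N -> K -> M), (forall i, linear (h i)) /\
    forall f : K -> M, linear f -> exists c : 'I_N -> S, forall x, f x = \sum_i c i *: h i x.
Proof.
move=> [n [e eP]] /(@ffun_fg _ n) Mn_fg.
pose P (y : {ffun 'I_n -> M}) := exists2 f : K -> M, linear f & forall j, y j = f (e j).
have sP : submodule P.
  split; first by exists (fun=> 0) => [c x y|j]; rewrite ?ffunE // scaler0 addr0.
  move=> c x y [f fl fE] [g gl gE]; exists (fun z => c *: f z + g z).
    by apply: add_is_linear => //; exact: scale_is_linear.
  by move=> j; rewrite !ffunE fE gE.
have [N [y [yP ygen]]] := submodule_fg Mn_fg sP.
have /choice[h hP] : forall i, exists f : K -> M, linear f /\ forall j, y i j = f (e j).
  by move=> i; have [f fl fE] := yP i; exists f.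
exists N, h; split=> [i|f fl]; first by case: (hP i).
have [|c cE] := ygen [ffun j => f (e j)]; first by exists f => // j; rewrite ffunE.
exists c => x; have [d ->] := eP x.
rewrite (linear_fun_sum fl).
under [RHS]eq_bigr => i _ do rewrite (linear_fun_sum (hP i).1) scaler_sumr.
rewrite exchange_big /=; apply: eq_bigr => j _; rewrite (linear_funZ fl).
have := congr1 (fun z : {ffun 'I_n -> M} => z j) cE; rewrite ffunE sum_ffunE => ->.
rewrite scaler_sumr; apply: eq_bigr => i _.
by rewrite ffunE (hP i).2 (linear_funZ (hP i).1) !scalerA mulrC.
Qed.

End FinitelyGenerated.

(** * The endomorphism ring of a module *)

Section EndomorphismRing.
Variables (S : comPzRingType) (K : lmodType S).

Definition endo : Type := {f : K -> K | `[< linear f >]}.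
HB.instance Definition _ := gen_eqMixin endo.
HB.instance Definition _ := gen_choiceMixin endo.

Definition endo_fun (f : endo) : K -> K := sval f.

Lemma endo_linear (f : endo) : linear (endo_fun f).
Proof. by case: f => f; rewrite /endo_fun /= => /asboolP. Qed.

Lemma endo_ext (f g : endo) : endo_fun f =1 endo_fun g -> f = g.
Proof.
case: f g => [f fl] [g gl]; rewrite /endo_fun /= => /funext fg; subst g.
by congr exist; exact: Prop_irrelevance.
Qed.

Definition mk_endo (f : K -> K) (fl : linear f) : endo := exist _ f (asboolT fl).

Lemma linear_id : linear (@id K). Proof. by []. Qed.
Lemma linear_zero : linear (fun _ : K => 0 : K).
Proof. by move=> c x y; rewrite scaler0 addr0. Qed.
Lemma linear_opp (f : endo) : linear (fun x => - endo_fun f x).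
Proof. by move=> c x y; rewrite endo_linear opprD scalerN. Qed.

Definition endo0 := mk_endo linear_zero.
Definition endo1 := mk_endo linear_id.
Definition endoN f := mk_endo (linear_opp f).
Definition endoD f g := mk_endo (add_is_linear (endo_linear f) (endo_linear g)).
Definition endoM f g := mk_endo (comp_is_linear (endo_linear f) (endo_linear g)).

Lemma endoDA : associative endoD.
Proof. by move=> f g h; apply: endo_ext => x; exact: addrA. Qed.
Lemma endoDC : commutative endoD.
Proof. by move=> f g; apply: endo_ext => x; exact: addrC. Qed.
Lemma endo0D : left_id endo0 endoD.
Proof. by move=> f; apply: endo_ext => x; exact: add0r. Qed.
Lemma endoND : left_inverse endo0 endoN endoD.
Proof. by move=> f; apply: endo_ext => x; exact: addNr. Qed.
HB.instance Definition _ := GRing.isZmodule.Build endo endoDA endoDC endo0D endoND.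

Lemma endoMA : associative endoM.
Proof. by move=> f g h; apply: endo_ext. Qed.
Lemma endo1M : left_id endo1 endoM.
Proof. by move=> f; apply: endo_ext. Qed.
Lemma endoM1 : right_id endo1 endoM.
Proof. by move=> f; apply: endo_ext. Qed.
Lemma endoMDl : left_distributive endoM +%R.
Proof. by move=> f g h; apply: endo_ext. Qed.
Lemma endoMDr : right_distributive endoM +%R.
Proof. by move=> f g h; apply: endo_ext => x; exact: (linear_funD (endo_linear f)). Qed.
HB.instance Definition _ := GRing.Zmodule_isPzRing.Build endo
  endoMA endo1M endoM1 endoMDl endoMDr.

Lemma endo_fun0 x : endo_fun 0 x = 0. Proof. by []. Qed.
Lemma endo_fun1 x : endo_fun 1 x = x. Proof. by []. Qed.
Lemma endo_funM f g x : endo_fun (f * g) x = endo_fun f (endo_fun g x). Proof. by []. Qed.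
Lemma endo_funD f g x : endo_fun (f + g) x = endo_fun f x + endo_fun g x. Proof. by []. Qed.
Lemma endo_fun_sum (I : finType) (F : I -> endo) x :
  endo_fun (\sum_i F i) x = \sum_i endo_fun (F i) x.
Proof. exact: (big_morph (fun f => endo_fun f x) (fun f g => endo_funD f g x) (endo_fun0 x)). Qed.

Definition homothety (s : S) : endo := mk_endo (scale_is_linear s linear_id).

Lemma homothety_rmorphism : exists g : {rmorphism S -> endo}, g =1 homothety.
Proof.
apply: rmorphism_of_fun => [|s t|s t]; apply: endo_ext => x.
- exact: scale1r.
- exact: scalerDl.
- by rewrite [RHS]scalerA.
Qed.

Lemma homothetyC s f : homothety s * f = f * homothety s.
Proof. by apply: endo_ext => x; rewrite !endo_funM; exact/esym/(linear_funZ (endo_linear f)). Qed.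

End EndomorphismRing.

Lemma endo_fg (S : comPzRingType) (K : lmodType S) : noetherian S -> finitely_generated K ->
  exists N (e : 'I_N -> endo K), forall x, exists c : 'I_N -> S,
    x = \sum_i homothety K (c i) * e i.
Proof.
move=> S_noeth Kfg; have [N [h [hl hgen]]] := hom_fg S_noeth Kfg Kfg.
exists N, (fun i => mk_endo (hl i)) => f; have [c cE] := hgen _ (endo_linear f).
by exists c; apply: endo_ext => x; rewrite endo_fun_sum cE.
Qed.

Lemma pair_ext (T U : Type) (z w : T * U) : z.1 = w.1 -> z.2 = w.2 -> z = w.
Proof. by case: z w => [? ?] [? ?] /= -> ->. Qed.

(** * Cancellation from a split map *)

Section Cancellation.
Variables (S : comPzRingType) (K L M : lmodType S).

(** Being the identity on [K], [G] induces an isomorphism of the quotients by [K], which are [L] and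
    [M]. *)
Lemma isomorphic_of_identity_on_summand (G : K * L -> K * M) (G' : K * M -> K * L) :
  linear G -> cancel G G' -> cancel G' G -> (forall k, G (k, 0) = (k, 0)) ->
  isomorphic L M.
Proof.
move=> Gl GG' G'G G1; have G'l := linear_inverse Gl GG' G'G.
have G'1 k : G' (k, 0) = (k, 0) by rewrite -G1 GG'.
have fl : linear (fun l => (G (0, l)).2).
  move=> c x y; have -> : (0, c *: x + y) = c *: (0, x) + (0, y) :> K * L.
    by congr pair; rewrite /= scaler0 addr0.
  by rewrite Gl.
have [f fE] := linear_of_fun fl; exists f, (fun m => (G' (0, m)).2).
- move=> l; rewrite fE; have := GG' (0, l); case: (G (0, l)) => k m /= e.
  have -> : (0, m) = (k, m) - (k, 0) :> K * M by congr pair; rewrite /= ?subrr ?subr0.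
  by rewrite (linear_funB G'l) e G'1 /= subr0.
- move=> m; rewrite fE; have := G'G (0, m); case: (G' (0, m)) => k l /= e.
  have -> : (0, l) = (k, l) - (k, 0) :> K * L by congr pair; rewrite /= ?subrr ?subr0.
  by rewrite (linear_funB Gl) e G1 /= subr0.
Qed.

(* Three elementary automorphisms of [K * M] carry [x |-> F (x, 0)] to the inclusion of [K]. *)
Lemma isomorphic_of_split (F : K * L -> K * M) (F' : K * M -> K * L)
    (h : K -> M) (g : M -> K) :
  linear F -> cancel F F' -> cancel F' F -> linear h -> linear g ->
  (forall x, g ((F (x, 0)).2 + h (F (x, 0)).1) = x) -> isomorphic L M.
Proof.
move=> Fl FF' F'F hl gl gh.
pose a x := (F (x, 0)).1; pose w x := (F (x, 0)).2 + h (a x).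
have al : linear a.
  move=> c x y; rewrite /a; have -> : (c *: x + y, 0) = c *: (x, 0) + (y, 0) :> K * L.
    by congr pair; rewrite /= scaler0 addr0.
  by rewrite Fl.
have wl : linear w.
  apply: add_is_linear; last exact: comp_is_linear.
  move=> c x y; have -> : (c *: x + y, 0) = c *: (x, 0) + (y, 0) :> K * L.
    by congr pair; rewrite /= scaler0 addr0.
  by rewrite Fl.
(* Since [u (w x) = x - a x], the maps [T1], [T2], [T3] carry [F (x, 0)] to [(a x, w x)], [(x, w x)]
   and [(x, 0)] in turn. *)
pose u y := g y - a (g y).
pose T1 (z : K * M) : K * M := (z.1, z.2 + h z.1).
pose T2 (z : K * M) : K * M := (z.1 + u z.2, z.2).
pose T3 (z : K * M) : K * M := (z.1, z.2 - w z.1).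
pose T1' (z : K * M) : K * M := (z.1, z.2 - h z.1).
pose T2' (z : K * M) : K * M := (z.1 - u z.2, z.2).
pose T3' (z : K * M) : K * M := (z.1, z.2 + w z.1).
have ul : linear u by apply: sub_is_linear => //; exact: comp_is_linear.
have T1l : linear T1 by move=> c x y; apply: pair_ext; rewrite //= hl scalerDr addrACA.
have T2l : linear T2 by move=> c x y; apply: pair_ext; rewrite //= ul (scalerDr c x.1) addrACA.
have T3l : linear T3.
  by move=> c x y; apply: pair_ext; rewrite //= wl scalerBr opprD addrACA.
apply: (@isomorphic_of_identity_on_summand (fun z => T3 (T2 (T1 (F z))))
  (fun z => F' (T1' (T2' (T3' z))))).
- by do 3![apply: comp_is_linear => //].
- move=> z; rewrite -[RHS]FF'; congr F'; apply: pair_ext;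
    by rewrite /T1' /T2' /T3' /T1 /T2 /T3 /= subrK addrK ?addrK.
- move=> z; rewrite F'F; apply: pair_ext;
    by rewrite /T1' /T2' /T3' /T1 /T2 /T3 /= ?subrK ?addrK.
move=> x; rewrite /T1 /T2 /T3 /= -/(a x) -/(w x).
have -> : u (w x) = x - a x by rewrite /u gh.
by rewrite addrC subrK subrr.
Qed.

End Cancellation.

(** * Localization *)

Section LocalizationFacts.
Variables (S : comPzRingType) (p : spec S).

Definition loc_ring_of (s : S) : loc_ring p := loc_frac (s : S^o) (denom1 p).
Definition loc_of (V : lmodType S) (x : V) : loc p V := loc_frac x (denom1 p).

Variable V : lmodType S.
Implicit Types x y : V.

Lemma denom_outside (s : denom p) : ~ spec_set p (sval s).
Proof. by case: s => s /=; rewrite inE. Qed.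

Lemma loc_of_eq x y : loc_of x = loc_of y <-> exists2 s, ~ spec_set p s & s *: x = s *: y.
Proof.
rewrite /loc_of eq_loc_frac; split=> [[u]|[s ps e]].
  by rewrite /= !scale1r => e; exists (sval u) => //; exact: denom_outside.
have sp : s \in ~` spec_set p by rewrite inE.
by exists (exist _ s sp); rewrite /= !scale1r.
Qed.

Lemma loc_ofD x y : loc_of (x + y) = loc_of x + loc_of y.
Proof.
rewrite /loc_of [RHS]loc_addE; apply/eq_loc_frac; exists (denom1 p).
by rewrite /= !scale1r mulr1 scale1r.
Qed.

Lemma loc_ofZ s x : loc_of (s *: x) = loc_ring_of s *: loc_of x.
Proof.
rewrite /loc_of [RHS]loc_scaleE; apply/eq_loc_frac; exists (denom1 p).
by rewrite /= !scale1r mulr1 scale1r.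
Qed.

Lemma loc_of0 : loc_of (0 : V) = 0. Proof. by []. Qed.

Lemma loc_of_sum (I : finType) (F : I -> V) : loc_of (\sum_i F i) = \sum_i loc_of (F i).
Proof. exact: (big_morph _ loc_ofD loc_of0). Qed.

Lemma loc_ring_ofM s t : loc_ring_of (s * t) = loc_ring_of s * loc_ring_of t.
Proof.
rewrite /loc_ring_of [RHS]loc_scaleE; apply/eq_loc_frac; exists (denom1 p).
by rewrite /= !scale1r mulr1 scale1r.
Qed.

Lemma loc_of_surj (z : loc p V) : exists2 s, ~ spec_set p s &
  exists x, loc_ring_of s *: z = loc_of x.
Proof.
have [x [s ->]] := loc_fracP z; exists (sval s); first exact: denom_outside.
exists x; rewrite [LHS]loc_scaleE; apply/eq_loc_frac; exists (denom1 p).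
by rewrite /= !scale1r mul1r.
Qed.

End LocalizationFacts.

Section LocalHom.
Variables (S : comPzRingType) (p : spec S).
Hypothesis S_noeth : noetherian S.

(* [K] is finitely presented, so that numerators of the images of its generators respect
   its relations after multiplication by a single element outside [p]. *)
Lemma local_hom_lift (K M : lmodType S) (phi : loc p K -> loc p M) :
  finitely_generated K -> linear phi ->
  exists2 s, ~ spec_set p s & exists a : K -> M, linear a /\
    forall x, loc_ring_of p s *: phi (loc_of p x) = loc_of p (a x).
Proof.
move=> [n [e eP]] phil.
have [|j|s ps /choice[m mE]] := @common_denominator S p 'I_n (fun j s =>
    exists m, loc_ring_of p s *: phi (loc_of p (e j)) = loc_of p m).
- by move=> j s t [m mE]; exists (t *: m); rewrite loc_ring_ofM -scalerA mE loc_ofZ.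
- have [s ps [x xE]] := loc_of_surj (phi (loc_of p (e j))).
  by exists s => //; exists x.
pose P (c : {ffun 'I_n -> S^o}) := \sum_j (c j : S) *: e j = 0.
have Sfg : finitely_generated S^o.
  by exists 1%N, (fun=> 1) => x; exists (fun=> x); rewrite big_ord1 /GRing.scale /= mulr1.
have [N [r [rP rgen]]] : exists N (h : 'I_N -> {ffun 'I_n -> S^o}), (forall i, P (h i)) /\
    forall x, P x -> exists c : 'I_N -> S, x = \sum_i c i *: h i.
  apply: submodule_fg => //; first exact: ffun_fg.
  split; first by rewrite /P big1 // => j _; rewrite ffunE scale0r.
  move=> c x y Px Py; rewrite /P.
  have cxy j : (c *: x + y) j = c * (x j : S) + (y j : S) :> S by rewrite !ffunE.
  under eq_bigr => j _ do rewrite cxy scalerDl -scalerA.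
  by rewrite big_split /= -scaler_sumr [X in _ *: X]Px Py scaler0 addr0.
have phi_sum (c : 'I_n -> S) : loc_of p (\sum_j c j *: m j) =
    loc_ring_of p s *: phi (loc_of p (\sum_j c j *: e j)).
  rewrite !loc_of_sum (linear_fun_sum phil) scaler_sumr; apply: eq_bigr => j _.
  by rewrite !loc_ofZ (linear_funZ phil) -mE !scalerA mulrC.
have [|i|v pv vP] := @common_denominator S p 'I_N (fun i v =>
    v *: (\sum_j (r i j : S) *: m j) = 0).
- by move=> i v t h; rewrite -scalerA h scaler0.
- have : loc_of p (\sum_j (r i j : S) *: m j) = loc_of p 0.
    by rewrite phi_sum (rP i) loc_of0 (linear_fun0 phil) scaler0.
  by move=> /loc_of_eq[v pv h]; exists v => //; rewrite h scaler0.
have rel (c : 'I_n -> S) : \sum_j c j *: e j = 0 -> v *: \sum_j c j *: m j = 0.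
  move=> c0; have [|d dE] := rgen [ffun j => c j : S^o].
    by rewrite /P -[RHS]c0; apply: eq_bigr => j _; rewrite ffunE.
  have cE j : c j = \sum_i d i * (r i j : S).
    have := congr1 (fun f : {ffun 'I_n -> S^o} => f j) dE; rewrite ffunE sum_ffunE => ->.
    by apply: eq_bigr => i _; rewrite ffunE.
  under eq_bigr => j _ do rewrite cE scaler_suml.
  rewrite exchange_big /= scaler_sumr big1 // => i _.
  under eq_bigr => j _ do rewrite -scalerA.
  by rewrite -scaler_sumr scalerA mulrC -scalerA vP scaler0.
have [c cP] := choice eP.
(* The coefficients [c x] are chosen arbitrarily; the factor [v] makes the value independent of
   them, hence linear in [x]. *)
pose a x := v *: \sum_j c x j *: m j.
have aE x (d : 'I_n -> S) : x = \sum_j d j *: e j -> a x = v *: \sum_j d j *: m j.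
  move=> xE; apply/eqP; rewrite -subr_eq0 -scalerBr -sumrB.
  under eq_bigr => j _ do rewrite -scalerBl.
  rewrite rel //; under eq_bigr => j _ do rewrite scalerBl.
  by rewrite sumrB -cP -xE subrr.
exists (v * s); first exact: notin_primeM.
exists a; split.
  move=> b x y; rewrite (aE _ (fun j => b * c x j + c y j)).
    rewrite /a scalerA [b * v]mulrC -scalerA -scalerDr; congr (_ *: _).
    rewrite scaler_sumr -big_split; apply: eq_bigr => j _.
    by rewrite scalerDl scalerA.
  rewrite {1}(cP x) {1}(cP y) scaler_sumr -big_split; apply: eq_bigr => j _.
  by rewrite scalerDl scalerA.
by move=> x; rewrite /a loc_ofZ phi_sum -cP scalerA -loc_ring_ofM.
Qed.

(** The inclusions and projections of the summands lift up to denominators [s] and [t]; a further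
    factor [v] makes the identities between them, valid after localization, hold on the generators
    of [K]. *)
Lemma local_summand_split (K M : lmodType S) u :
  finitely_generated K -> finitely_generated M ->
  direct_summand {ffun 'I_u -> loc p K} (loc p M) ->
  exists (al : 'I_u -> K -> M) (be : 'I_u -> M -> K) (s : S), [/\ ~ spec_set p s,
    forall j, linear (al j), forall i, linear (be i) &
    forall i j x, be i (al j x) = if i == j then s *: x else 0].
Proof.
move=> Kfg Mfg [B [f [f' ff' f'f]]].
have fl : linear f by move=> c x y; exact: linearP.
have f'l := linear_inverse fl ff' f'f.
pose d (j : 'I_u) (z : loc p K) : {ffun 'I_u -> loc p K} := [ffun i => if i == j then z else 0].
pose phi j z := f' (d j z, 0).
pose psi i y := (f y).1 i.
have phil j : linear (phi j).
  move=> c x y; rewrite /phi -f'l; congr f'; apply: pair_ext => /=; last by rewrite scaler0 addr0.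
  by apply/ffunP => i; rewrite !ffunE; case: eqP => // _; rewrite scaler0 addr0.
have psil i : linear (psi i) by move=> c x y; rewrite /psi fl /= !ffunE.
have psiphi i j z : psi i (phi j z) = if i == j then z else 0.
  by rewrite /psi /phi f'f /= ffunE.
have [|j|s ps /choice[al alP]] := @common_denominator S p 'I_u (fun j s =>
    exists a : K -> M, linear a /\
      forall x, loc_ring_of p s *: phi j (loc_of p x) = loc_of p (a x)).
- move=> j s t [a [al aE]]; exists (fun x => t *: a x); split; first exact: scale_is_linear.
  by move=> x; rewrite loc_ring_ofM -scalerA aE loc_ofZ.
- by have [s ps ?] := local_hom_lift Kfg (phil j); exists s.
have [|i|t pt /choice[be beP]] := @common_denominator S p 'I_u (fun i s =>
    exists a : M -> K, linear a /\
      forall x, loc_ring_of p s *: psi i (loc_of p x) = loc_of p (a x)).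
- move=> j r t [a [al' aE]]; exists (fun x => t *: a x); split; first exact: scale_is_linear.
  by move=> x; rewrite loc_ring_ofM -scalerA aE loc_ofZ.
- by have [r pr ?] := local_hom_lift Mfg (psil i); exists r.
have [n [e eP]] := Kfg.
have [|[[i j] l]|v pv vP] := @common_denominator S p ('I_u * 'I_u * 'I_n)%type (fun ijl v =>
    v *: be ijl.1.1 (al ijl.1.2 (e ijl.2)) =
    v *: (if ijl.1.1 == ijl.1.2 then (t * s) *: e ijl.2 else 0)).
- by move=> ijl v w h; rewrite -[LHS]scalerA h scalerA.
- have : loc_of p (be i (al j (e l))) = loc_of p (if i == j then (t * s) *: e l else 0).
    rewrite -(beP i).2 -(alP j).2 (linear_funZ (psil i)) psiphi scalerA -loc_ring_ofM.
    by case: eqP => _; rewrite ?loc_ofZ // scaler0 loc_of0.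
  by move=> /loc_of_eq[v pv h]; exists v.
exists al, (fun i y => v *: be i y), (v * (t * s)); split.
- by do 2![apply: notin_primeM => //].
- by move=> j; case: (alP j).
- by move=> i; apply: scale_is_linear; case: (beP i).
- move=> i j x; have [c ->] := eP x.
  have [[all _] [bel _]] := (alP j, beP i).
  rewrite (linear_fun_sum all) (linear_fun_sum bel) scaler_sumr.
  have -> : (if i == j then (v * (t * s)) *: (\sum_l c l *: e l) else 0) =
      \sum_l c l *: (v *: (if i == j then (t * s) *: e l else 0)).
    case: eqP => _; last by rewrite big1 // => l _; rewrite !scaler0.
    by rewrite scaler_sumr; apply: eq_bigr => l _; rewrite !scalerA; congr (_ *: _); ring.
  apply: eq_bigr => l _; rewrite (linear_funZ all) (linear_funZ bel).
  rewrite [LHS]scalerA (mulrC v) -[LHS]scalerA; congr (_ *: _); exact: (vP (i, j, l)).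
Qed.

(** If the localization vanishes, each generator is killed by an element outside [p], and a common
    such element annihilates [K]. *)
Lemma Supp_annihilator (K : lmodType S) : finitely_generated K ->
  Supp K p <-> forall s, (forall x : K, s *: x = 0) -> spec_set p s.
Proof.
move=> [n [e eP]]; split=> [[z /eqP z0] s sK|annp].
  apply: contrapT => ps; apply: z0; have [x [t ->]] := loc_fracP z.
  apply/eq_loc_frac.
  have sp : s \in ~` spec_set p by rewrite inE.
  by exists (exist _ s sp); rewrite /= !sK.
apply: contrapT => nz.
have [|i|v pv vP] := @common_denominator S p 'I_n (fun i v => v *: e i = 0).
- by move=> i s t h; rewrite -scalerA h scaler0.
- have : loc_of p (e i) = loc_of p 0.
    by apply: contrapT => /eqP ei; apply: nz; exists (loc_of p (e i)).
  by move=> /loc_of_eq[s ps h]; exists s => //; rewrite h scaler0.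
apply/pv/annp => x; have [c ->] := eP x; rewrite scaler_sumr big1 // => i _.
by rewrite scalerA mulrC -scalerA vP scaler0.
Qed.

End LocalHom.

(** * Chains of irreducible closed subsets *)

Definition specializes (T : topologicalType) (y z : T) : Prop :=
  forall B, closed B -> B y -> B z.

Lemma specializes_subtype (T : topologicalType) (A : set T) (y z : A) :
  specializes (val y) (val z) -> specializes y z.
Proof.
move=> yz B cB By.
have : open (~` B) by rewrite openC.
move=> [V oV VB]; apply: contrapT => Bz.
have Vz : V (val z) by have : (~` B) z by []; rewrite -VB.
have : (~` V) (val y) by move=> Vy; have : (~` B) y by rewrite -VB.
have cV : closed (~` V) by rewrite closedC.
by move=> /(yz _ cV).
Qed.

Lemma closed_subtype (T : topologicalType) (A : set T) (C : set T) :
  closed C -> closed [set y : A | C (val y)].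
Proof.
move=> cC; rewrite -openC; exists (~` C); first by rewrite openC.
by [].
Qed.

Section Chains.
Variable S : comPzRingType.
Implicit Types (p q : spec S).

Lemma specializes_spec p q : spec_set p `<=` spec_set q -> specializes p q.
Proof.
move=> pq B cB Bp; have : open (~` B) by rewrite openC.
move=> [Z /(congr1 setC)]; rewrite !setCK => BZ.
by move: Bp; rewrite BZ /zariski_closed /= => Zp z /Zp /pq.
Qed.

Lemma zariski_closedP (E : set S) : closed (zariski_closed E).
Proof. by rewrite -openC; exists E. Qed.

Variable X : set (spec S).

Lemma prime_chain_seq n p : X p -> prime_chain X n p -> exists q : nat -> spec S,
  [/\ q 0%N = p, forall i, X (q i),
      forall i j, (i <= j)%N -> spec_set (q i) `<=` spec_set (q j) &
      forall i j, (i < j <= n)%N -> q i <> q j].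
Proof.
elim: n p => [|n IH] p Xp /=.
  by move=> _; exists (fun=> p); split=> // i j ij //; exfalso; lia.
move=> [p' [Xp' pp' p'p /(IH _ Xp')[q [q0 Xq qle qne]]]].
exists (fun i => if i is i'.+1 then q i' else p); split=> // [[|i] //|i j|i j].
  case: i j => [|i] [|j] ij //; last exact: (qle i j).
  by apply: (subset_trans pp'); rewrite -q0; exact: (qle 0%N j).
case: i j => [|i] [|j] ij //; last exact: (qne i j).
move=> pq; apply: p'p; apply: spec_inj; apply/seteqP; split=> //.
by rewrite pq -q0; exact: qle.
Qed.

(** Larger primes have smaller closures, hence the index [n - i]. Each member consists of the points
    containing one prime of the chain, which is its generic point and makes it irreducible. *)
Lemma prime_chain_irreducible_chain n (p : X) : prime_chain X n (val p) ->
  irreducible_chain (closure [set p]) n.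
Proof.
have Xval (y : X) : X (val y) by exact: set_valP.
move=> /(prime_chain_seq (Xval p))[q [q0 Xq qle qne]].
have pt i : exists y : closure [set p], val (val y) = q i.
  pose x : X := SigSub (mem_set (Xq i)).
  have cx : closure [set p] x.
    have : specializes p x.
      apply: specializes_subtype; apply: specializes_spec.
      by have := qle 0%N i (leq0n i); rewrite q0.
    by apply; [exact: closed_closure|apply: subset_closure].
  by exists (SigSub (mem_set cx)).
have sp (y z : closure [set p]) : spec_set (val (val y)) `<=` spec_set (val (val z)) ->
    specializes y z.
  by move=> yz; do 2 apply: specializes_subtype; exact: specializes_spec.
exists (fun i => [set y | spec_set (q (n - i)%N) `<=` spec_set (val (val y))]); split.
- move=> i; split.
    have h : closed [set y : X | zariski_closed (spec_set (q (n - i)%N)) (val y)].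
      by apply: closed_subtype; exact: zariski_closedP.
    exact: (closed_subtype h).
  have [y yE] := pt (n - i)%N; split; first by exists y; rewrite /= yE.
  move=> B C cB cC /(_ y) []; first by rewrite /= yE.
    by move=> By; left=> z /= qz; apply: (sp y z) => //; rewrite yE.
  by move=> Cy; right=> z /= qz; apply: (sp y z) => //; rewrite yE.
- move=> i j ij; split.
    by move=> y /= qy; apply: subset_trans qy; apply: qle; lia.
  move=> /(_ _) sub; have [y yE] := pt (n - j)%N.
  have /= := sub y; rewrite yE => /(_ (@subset_refl _ _)) qq.
  apply: (qne (n - j)%N (n - i)%N); first by have := ltn_ord j; lia.
  by apply: spec_inj; apply/seteqP; split=> //; apply: qle; lia.
Qed.

End Chains.

Theorem theorem1p1 (S : comPzRingType) (K L M : lmodType S) :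
  noetherian S ->
  finitely_generated K -> finitely_generated L -> finitely_generated M ->
  let X := (jspec S `&` Supp K)%classic in
  (forall p : X,
     (forall d : nat, has_krull_dim (closure [set p])%classic d ->
        direct_summand {ffun 'I_(1 + d) -> loc (val p) K} (loc (val p) M)) /\
     (infinite_krull_dim (closure [set p])%classic ->
        forall n : nat,
          direct_summand {ffun 'I_n -> loc (val p) K} (loc (val p) M))) ->
  isomorphic (K * L)%type (K * M)%type -> isomorphic L M.
Proof.
move=> S_noeth Kfg Lfg Mfg X summand [F [F' FF' F'F]].
have [iota iotaE] := homothety_rmorphism K.
have iotaC s f : iota s * f = f * iota s by rewrite iotaE homothetyC.
have iota_fun s x : endo_fun (iota s) x = s *: x by rewrite iotaE.
have iota0 s : iota s = 0 <-> forall x : K, s *: x = 0.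
  split=> [h x|h]; first by rewrite -iota_fun h.
  by apply: endo_ext => x; rewrite iota_fun h.
have E_fg : exists N (e : 'I_N -> endo K), forall x, exists c : 'I_N -> S,
    x = \sum_i iota (c i) * e i.
  have [N [e eP]] := endo_fg S_noeth Kfg; exists N, e => x; have [c ->] := eP x.
  by exists c; apply: eq_bigr => i _; rewrite iotaE.
have suppE p : Supp K p <-> forall s, iota s = 0 -> spec_set p s.
  rewrite Supp_annihilator //.
  by split=> h s; [move/iota0; exact: h|move/iota0; exact: h].
have X_supp p : X p -> forall s, iota s = 0 -> spec_set p s by move=> [_ /suppE].
have X_maximal p : maximal_ideal (spec_set p) ->
    (forall s, iota s = 0 -> spec_set p s) -> X p.
  move=> mp /suppE sp; split=> //; exists [set spec_set p]; split; first by move=> _ ->.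
  by rewrite bigcap_set1.
have X_bigcap (D : set (spec S)) q : D `<=` X ->
    spec_set q = \bigcap_(p in D) spec_set p -> X q.
  move=> DX qE; split; last first.
    by apply/suppE => s s0; rewrite qE => p /DX /X_supp; apply.
  (* Every [p] in [D] is an intersection of maximal ideals, so the maximal ideals above the members
     of [D] together cut out [q]. *)
  exists [set m | maximal_ideal m /\ exists2 p, D p & spec_set p `<=` m].
  split; first by move=> m [].
  rewrite qE; apply/seteqP; split=> s sq.
    by move=> m [_ [p Dp pm]]; apply/pm/sq.
  move=> p Dp; have [[G [Gm GE]] _] := DX p Dp.
  rewrite GE => m Gm'; apply: sq; split; first exact: Gm.
  by exists p => // z; rewrite GE; apply.
have [t [m [ml mgen]]] := hom_fg S_noeth Kfg Mfg.
have [r [g [gl ggen]]] := hom_fg S_noeth Mfg Kfg.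
have Fl : linear F by move=> c x y; exact: linearP.
have F'l := linear_inverse Fl FF' F'F.
have inl_linear (V : lmodType S) : linear (fun x : K => (x, 0) : K * V).
  by move=> c x y; apply: pair_ext; rewrite //= scaler0 addr0.
have inr_linear : linear (fun y : M => (0, y) : K * M).
  by move=> c x y; apply: pair_ext; rewrite //= scaler0 addr0.
have fst_linear (V : lmodType S) : linear (@fst K V) by [].
have snd_linear : linear (@snd K M) by [].
have al : linear (fun x => (F (x, 0)).1).
  exact: (comp_is_linear (fst_linear M) (comp_is_linear Fl (inl_linear L))).
have ul : linear (fun x => (F (x, 0)).2).
  exact: (comp_is_linear snd_linear (comp_is_linear Fl (inl_linear L))).
have bl : linear (fun x => (F' (x, 0)).1).
  exact: (comp_is_linear (fst_linear L) (comp_is_linear F'l (inl_linear M))).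
have wl : linear (fun y => (F' (0, y)).1).
  exact: (comp_is_linear (fst_linear L) (comp_is_linear F'l inr_linear)).
have [c cE] := ggen _ wl.
pose N : 'cV[endo K]_r := \col_j mk_endo (comp_is_linear (gl j) ul).
pose Psi : 'M[endo K]_(r, t) := \matrix_(j, i) mk_endo (comp_is_linear (gl j) (ml i)).
pose a : 'M[endo K]_1 := (mk_endo al)%:M.
pose b : 'M[endo K]_1 := (mk_endo bl)%:M.
pose gv : 'rV[endo K]_r := \row_j iota (c j).
(* This is the first component of [F' (F (x, 0)) = (x, 0)], with the restriction of [F'] to [M]
   expanded in the generators [g j]. *)
have baN : b *m a + gv *m N = 1%:M.
  apply/matrixP => i j; rewrite !ord1 -scalar_mxM !mxE eqxx !mulr1n.
  apply: endo_ext => x; rewrite endo_funD endo_funM endo_fun_sum endo_fun1.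
  under eq_bigr => l _ do rewrite !mxE endo_funM iota_fun.
  have -> : \sum_l c l *: endo_fun (mk_endo (comp_is_linear (gl l) ul)) x =
      (F' (0, (F (x, 0)).2)).1 by rewrite cE.
  rewrite -[RHS]/((x, 0) : K * L).1 -[in RHS](FF' (x, 0)).
  rewrite -[endo_fun (mk_endo bl) _]/((F' ((F (x, 0)).1, 0)).1).
  case: (F (x, 0)) => y z /=.
  have -> : (y, z) = (y, 0) + (0, z) :> K * M by apply: pair_ext; rewrite /= ?addr0 ?add0r.
  by rewrite (linear_funD F'l).
have cs : chain_split iota X (row_mx N Psi).
  move=> p Xp n pn.
  suff h : split_rank iota p n.+1 Psi.
    apply: split_rank_leq (geq_minr _ _) _.
    apply: (@split_rank_mulr _ _ _ _ _ _ _ _ _ (col_mx 0 1%:M)).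
    by rewrite mul_row_col mulmx0 add0r mulmx1.
  pose x : X := SigSub (mem_set Xp).
  have chn : irreducible_chain (closure [set x]) n by exact: prime_chain_irreducible_chain.
  have [s1 s2] := summand x.
  (* A prime chain of length [n] gives [n <= d], so [1 + d] copies exceed [n]; in infinite dimension
     [n.+1] copies are available. *)
  have [u nu /(local_summand_split S_noeth Kfg Mfg)[al' [be [s [ps all bel abE]]]]] :
      exists2 u, (n < u)%N & direct_summand {ffun 'I_u -> loc p K} (loc p M).
    have y : closure [set x] by exact: (SigSub (mem_set (@subset_closure _ [set x] x erefl))).
    have [[d dE]|inf] := krull_dim_exists y.
      by exists (1 + d)%N; [rewrite ltnS; case: dE => _; exact|exact: s1 dE].
    by exists n.+1 => //; exact: s2.
  apply: split_rank_leq nu _.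
  have /choice[d dE] := fun i => ggen _ (bel i).
  have /choice[f fE] := fun j => mgen _ (all j).
  (* The coefficients of [be i] in the [g k] and of [al' j] in the [m l]: the product with [Psi] is
     the matrix of composites of [be i] with [al' j], which is [s] times the identity. *)
  exists (\matrix_(i, l) iota (d i l)), (\matrix_(l, j) iota (f j l)), s; split=> //.
  apply/matrixP => i j; apply: endo_ext => z.
  rewrite mxE endo_fun_sum.
  transitivity (be i (al' j z)).
    rewrite fE (linear_fun_sum (bel i)); apply: eq_bigr => l _.
    rewrite endo_funM !mxE iota_fun (linear_funZ (bel i)) endo_fun_sum dE.
    rewrite scaler_sumr; apply: eq_bigr => k _.
    rewrite endo_funM !mxE iota_fun /endo_fun /= (linear_funZ (ml l)) (linear_funZ (gl k)).
    by rewrite !scalerA mulrC.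
  by rewrite abE mxE; case: (i == j); rewrite ?mulr1n ?mulr0n // iota_fun.
have [d [z zE]] := stable_range S_noeth iotaC E_fg X_bigcap X_supp X_maximal baN cs.
apply: (@isomorphic_of_split _ _ _ _ F F' (fun x => \sum_i m i (endo_fun (d i 0) x))
  (fun y => \sum_j endo_fun (z 0 j) (g j y))) => //.
- by apply: sum_is_linear => i; apply: comp_is_linear => //; exact: endo_linear.
- by apply: sum_is_linear => i; apply: comp_is_linear => //; exact: endo_linear.
move=> x; have := congr1 (fun e : 'M[endo K]_1 => endo_fun (e 0 0) x) zE.
rewrite !mxE endo_fun_sum => h; rewrite -[RHS]h; apply: eq_bigr => j _.
rewrite endo_funM; congr (endo_fun _ _).
rewrite (linear_funD (gl j)) !mxE endo_funD; congr (_ + _).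
rewrite (linear_fun_sum (gl j)) big_ord1 !mxE eqxx mulr1n endo_funM endo_fun_sum.
by apply: eq_bigr => i _; rewrite endo_funM !mxE.
Qed.
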